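(* Let $d\ge1$. Let $V\in C^2(\mathbb{R}^d;\mathbb{R})$ satisfy $V\ge 0$, $V(x)\to+\infty$ as $x\to\infty$, and $\nabla V(x)=o\left(V(x)^{3/4}\right)$ as $x\to\infty$, and let $b\in L^\infty(\mathbb{R}^d)$ be non-negative. Then $b$ satisfies the Dynamical Stabilization Condition $$\exists T>0,\ \exists R>0:\qquad \liminf_{\lambda\to+\infty}\ \inf_{\rho\in\{p=\lambda^2\}}\ \left\langle b*\kappa_{R/\sqrt{\lambda}}\right\rangle_{T/\lambda}(\rho)\ >\ 0$$ if and only if it satisfies both the Uniform Geometric Control Condition $$\exists T>0,\ \exists c>0:\ \forall (x_0,\nu_0)\in\mathbb{R}^d\times S^{d-1},\ \forall r>0,\qquad \frac{1}{2T}\int_{-T}^T (b*\kappa_r)(x_0+t\nu_0)\,dt\ge c$$ and the Turning Point Condition $$\exists R>0:\qquad \liminf_{x\to\infty}\ \frac{1}{|B_{R/V(x)^{1/4}}(x)|}\int_{B_{R/V(x)^{1/4}}(x)} b(y)\,dy>0.$$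
   Context: $B_r(x)$ is the open Euclidean ball of radius $r$ centred at $x$, $|A|$ is the $d$-dimensional Lebesgue measure of $A$, $\kappa:=\frac{1}{|B_1(0)|}\mathbf{1}_{B_1(0)}$ and $\kappa_r(x):=r^{-d}\kappa(x/r)$ for $r>0$. Classical dynamics: $p(x,\xi)=V(x)+\frac12|\xi|^2$ on $T^\star\mathbb{R}^d\simeq\mathbb{R}^{2d}$, and $(\varphi^t)_{t\in\mathbb{R}}$ is its Hamiltonian flow, i.e. $\varphi^t(x,\xi)=(x^t,\xi^t)$ solves $\dot x^t=\xi^t$, $\dot\xi^t=-\nabla V(x^t)$, $(x^0,\xi^0)=(x,\xi)$ (globally defined since the level sets of $p$ are compact). For a continuous function $K$ on $\mathbb{R}^d$ and $T>0$, $$\langle K\rangle_T(\rho):=\frac{1}{2T}\int_{-T}^T K\big(\pi(\varphi^t(\rho))\big)\,dt,\qquad \rho\in T^\star\mathbb{R}^d,$$ where $\pi(x,\xi)=x$. *)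

(* Defs.v *)
From HB Require Import structures.
From mathcomp Require Import all_boot all_order all_algebra.
From mathcomp Require Import all_classical all_reals all_analysis.

Set Implicit Arguments.
Unset Strict Implicit.
Unset Printing Implicit Defensive.

Import Order.TTheory GRing.Theory Num.Theory.
Import numFieldNormedType.Exports.

Local Open Scope classical_set_scope.
Local Open Scope ring_scope.

(* R^d is 'rV[R]_d. The library normed structure of 'rV[R]_d is the one of the
   sup norm; it is only used for its topology (continuity, differentiation).
   Lengths and balls below are Euclidean. *)

Section measurable_rV.
Context (R : realType) (n : nat).

Let coord (i : 'I_n) (x : 'rV[R]_n) : measurableTypeR R := x ord0 i.

Let rV_set0 : g_sigma_preimage coord set0.
Proof. exact: sigma_algebra0. Qed.

Let rV_setC A : g_sigma_preimage coord A -> g_sigma_preimage coord (~` A).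
Proof. exact: sigma_algebraC. Qed.

Let rV_bigcup (F : (set 'rV[R]_n)^nat) :
  (forall i, g_sigma_preimage coord (F i)) ->
  g_sigma_preimage coord (\bigcup_i (F i)).
Proof. exact: sigma_algebra_bigcup. Qed.

(* The sigma-algebra generated by the coordinates, i.e. the Borel one. *)
HB.instance Definition _ := @isMeasurable.Build default_measure_display
  'rV[R]_n (g_sigma_preimage coord) rV_set0 rV_setC rV_bigcup.

Lemma measurable_coord_rV (i : 'I_n) :
  measurable_fun [set: 'rV[R]_n] (fun x => x ord0 i : measurableTypeR R).
Proof.
move=> _ Y mY; rewrite setTI; apply: sub_sigma_algebra => /=.
rewrite -bigcup_seq/=; exists i => /=; first by rewrite mem_index_enum.
by exists Y => //; rewrite setTI.
Qed.

Lemma measurable_fun_rV d (T : measurableType d) (f : T -> 'rV[R]_n) :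
  (forall i, measurable_fun [set: T]
    (fun t => f t ord0 i : measurableTypeR R)) ->
  measurable_fun [set: T] f.
Proof.
move=> mf; suff h : g_sigma_preimage coord `<=` [set A | measurable (f @^-1` A)].
  by move=> _ A mA; rewrite setTI; exact: h.
apply: smallest_sub.
  split => /=.
  - by rewrite preimage_set0.
  - by move=> A mA; rewrite setTD preimage_setC; exact: measurableC.
  - by move=> F mF; rewrite preimage_bigcup; exact: bigcupT_measurable.
move=> A; rewrite -bigcup_seq/= => -[i _ [Y mY <-]]/=.
by rewrite setTI -comp_preimage -[X in measurable X]setTI; exact: mf.
Qed.

End measurable_rV.

Section lebesgue_rV.
Context (R : realType).
Local Open Scope ereal_scope.

Definition cons_rV n (p : measurableTypeR R * 'rV[R]_n) : 'rV[R]_n.+1 :=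
  row_mx (p.1)%:M p.2.

(* n-fold product of the Lebesgue measure on R, transported to row vectors; see
   lebesgue_rV_box. *)
Fixpoint lebesgue_rV n : set 'rV[R]_n -> \bar R :=
  match n with
  | 0%N => \d_ (0%R : 'rV[R]_0)
  | m.+1 => pushforward (lebesgue_measure \x @lebesgue_rV m) (@cons_rV m)
  end.

Let uncons_rV n (x : 'rV[R]_n.+1) : measurableTypeR R * 'rV[R]_n :=
  (x ord0 ord0, \row_i x ord0 (lift ord0 i)).

Let uncons_rVK n : cancel (@uncons_rV n) (@cons_rV n).
Proof.
move=> x; apply/rowP => i; rewrite /cons_rV mxE; case: splitP => j ij /=.
  by rewrite !mxE !ord1 eqxx mulr1n; congr (x _ _); apply/val_inj;
    rewrite /= ij ord1.
by rewrite !mxE; congr (x _ _); apply/val_inj; rewrite /= ij.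
Qed.

Let cons_rVK n : cancel (@cons_rV n) (@uncons_rV n).
Proof.
move=> [a v]; congr pair => /=.
  rewrite mxE; case: splitP => [j _|j]; last by [].
  by rewrite mxE !ord1 eqxx mulr1n.
apply/rowP => i; rewrite !mxE; case: splitP => [[[]]//|j] /= ij.
by congr (v _ _); apply/val_inj; case: ij.
Qed.

Lemma measurable_cons_rV n : measurable_fun setT (@cons_rV n).
Proof.
apply: measurable_fun_rV => i; case: (unliftP ord0 i) => [j ->|->].
  have -> : (fun p => @cons_rV n p ord0 (lift ord0 j) : measurableTypeR R) =
      (fun x : 'rV[R]_n => x ord0 j : measurableTypeR R) \o snd.
    apply/funext => p; have /rowP/(_ j) := congr1 snd (cons_rVK p).
    by rewrite mxE.
  by apply: measurableT_comp => //; exact: measurable_coord_rV.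
have -> : (fun p => @cons_rV n p ord0 ord0 : measurableTypeR R) = fst.
  by apply/funext => p; exact: (congr1 fst (cons_rVK p)).
exact: measurable_fst.
Qed.

Let measurable_uncons_rV n : measurable_fun setT (@uncons_rV n).
Proof.
apply/measurable_fun_pairP; split; first exact: measurable_coord_rV.
apply: measurable_fun_rV => i.
have -> : (fun x => (snd \o @uncons_rV n) x ord0 i : measurableTypeR R) =
    (fun x : 'rV[R]_n.+1 => x ord0 (lift ord0 i) : measurableTypeR R).
  by apply/funext => x; rewrite /= mxE.
exact: measurable_coord_rV.
Qed.

Let lebesgue_rV_subproof n :
  exists m : {sigma_finite_measure set 'rV[R]_n -> \bar R},
    @lebesgue_rV n = m :> (set 'rV[R]_n -> \bar R).
Proof.
elim: n => [|n [m mE]] /=.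
  by exists [the {sigma_finite_measure set _ -> \bar R} of
    \d_ (0%R : 'rV[R]_0)].
pose P : {measure set (measurableTypeR R * 'rV[R]_n)%type -> \bar R} :=
  lebesgue_measure \x m.
have sP : sigma_finite setT P.
  have /sigma_finiteP[F [TF ndF Foo]] := sigma_finiteT (@lebesgue_measure R).
  have /sigma_finiteP[G [TG ndG Goo]] := sigma_finiteT m.
  exists (fun k => F k `*` G k).
    rewrite -setXTT TF TG predeqE => -[x y]; split.
      move=> [/= [k _ Fkx] [l _ Gly]]; exists (maxn k l) => //; split.
      - by move: x Fkx; exact/subsetPset/ndF/leq_maxl.
      - by move: y Gly; exact/subsetPset/ndG/leq_maxr.
    by move=> [k _ []/= ? ?]; split; exists k.
  move=> k; have [? ?] := Foo k; have [? ?] := Goo k.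
  split; first exact: measurableX.
  by rewrite /P /= product_measure1E// lte_mul_pinfty// ge0_fin_numE.
pose Q : {measure set 'rV[R]_n.+1 -> \bar R} :=
  measure_function_pushforward__canonical__measure_function_Measure P
    (@measurable_cons_rV n).
have sQ : sigma_finite setT Q.
  have [F FT mF] := sP.
  exists (fun k => @uncons_rV n @^-1` F k).
    by rewrite -preimage_bigcup -FT preimage_setT.
  move=> k; split.
    rewrite -[X in measurable X]setTI; apply: measurable_uncons_rV => //.
    exact: (mF k).1.
  rewrite /Q /= /pushforward -comp_preimage.
  by rewrite (_ : _ \o _ = id) ?preimage_id ?(mF k).2//; apply/funext/cons_rVK.
pose sQ' := Measure_isSigmaFinite.Build _ _ _ Q sQ.
pose Q' : {sigma_finite_measure set 'rV[R]_n.+1 -> \bar R} :=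
  HB.pack (Measure.sort Q) sQ'.
by exists Q'; rewrite mE.
Qed.

Let lebesgue_rV0 n : @lebesgue_rV n set0 = 0.
Proof. by have [m ->] := lebesgue_rV_subproof n. Qed.

Let lebesgue_rV_ge0 n A : 0 <= @lebesgue_rV n A.
Proof. by have [m ->] := lebesgue_rV_subproof n. Qed.

Let lebesgue_rV_sigma_additive n : semi_sigma_additive (@lebesgue_rV n).
Proof.
by have [m ->] := lebesgue_rV_subproof n; exact: measure_semi_sigma_additive.
Qed.

HB.instance Definition _ n := isMeasure.Build _ _ _ (@lebesgue_rV n)
  (@lebesgue_rV0 n) (@lebesgue_rV_ge0 n) (@lebesgue_rV_sigma_additive n).

Let lebesgue_rV_sigma_finite n : sigma_finite setT (@lebesgue_rV n).
Proof. by have [m ->] := lebesgue_rV_subproof n; exact: sigma_finiteT. Qed.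

HB.instance Definition _ n := Measure_isSigmaFinite.Build _ _ _
  (@lebesgue_rV n) (@lebesgue_rV_sigma_finite n).

Lemma lebesgue_rV_box n (A : 'I_n -> set (measurableTypeR R)) :
  (forall i, measurable (A i)) ->
  lebesgue_rV [set x : 'rV[R]_n | forall i, A i (x ord0 i)] =
  \prod_(i < n) lebesgue_measure (A i).
Proof.
elim: n A => [|n ih] A mA.
  rewrite big_ord0 /= diracE mem_set//.
  by move=> [].
have mB : measurable
    [set x : 'rV[R]_n | forall i, A (lift ord0 i) (x ord0 i)].
  have -> : [set x : 'rV[R]_n | forall i, A (lift ord0 i) (x ord0 i)] =
      \bigcap_(i in [set: 'I_n])
        [set x : 'rV[R]_n | A (lift ord0 i) (x ord0 i)].
    by apply/seteqP; split => [x Ax i _|x Ax i]; apply: Ax.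
  apply: fin_bigcap_measurable => // i _.
  by rewrite -[X in measurable X]setTI; exact: measurable_coord_rV.
rewrite big_ord_recl -ih; last by move=> i; exact: mA.
rewrite -product_measure1E//.
rewrite /= /pushforward; congr ((_ \x _) _); apply/seteqP.
have c0 (p : (measurableTypeR R * 'rV[R]_n)%type) : cons_rV p ord0 ord0 = p.1 by have /(congr1 fst) := @cons_rVK n p.
have cS (p : (measurableTypeR R * 'rV[R]_n)%type) i : cons_rV p ord0 (lift ord0 i) = p.2 ord0 i.
  by have /(congr1 snd)/rowP/(_ i) := @cons_rVK n p; rewrite mxE.
split => [p Ap|p [A0 AS] i] /=.
  by split => [|i]; [rewrite -c0|rewrite -cS]; exact: Ap.
by case: (unliftP ord0 i) => [j ->|->]; rewrite ?cS ?c0//; exact: AS.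
Qed.

End lebesgue_rV.

Section euclidean.
Context (R : realType) (d : nat).
Implicit Types (x y : 'rV[R]_d) (r : R).

Definition enorm x : R := Num.sqrt (\sum_i x ord0 i ^+ 2).

Definition eball x r : set 'rV[R]_d := [set y | enorm (y - x) < r].

(* |A| as a real number (0 if A has infinite measure). *)
Definition volume (A : set 'rV[R]_d) : R := fine (lebesgue_rV A).

(* Neighbourhoods of infinity: complements of large Euclidean balls. *)
Definition at_infty : set_system 'rV[R]_d :=
  [set A | \forall r \near +oo, forall x, r < enorm x -> A x].

Global Instance at_infty_filter : Filter at_infty.
Proof.
split.
- exact: nearW.
- by move=> P Q; rewrite /at_infty /= => AP AQ; near=> r => x rx; split;
    move: x rx; near: r.
- move=> P Q PQ; rewrite /at_infty /=; apply: filterS => r + x rx.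
  by move=> /(_ x rx)/PQ.
Unshelve. all: by end_near. Qed.

Canonical at_infty_filterType := FilterType at_infty at_infty_filter.

End euclidean.
Arguments at_infty {R d}.

Section calculus.
Context (R : realType) (d : nat).
Implicit Types (f V : 'rV[R]_d -> R).

Definition basis_vec (i : 'I_d) : 'rV[R]_d := delta_mx ord0 i.

Definition partial f (i : 'I_d) : 'rV[R]_d -> R :=
  fun x => 'D_(basis_vec i) f x.

(* C^k: the iterated partial derivatives of order <= k exist everywhere and are
   continuous. *)
Fixpoint class_C (k : nat) f : Prop :=
  match k with
  | 0%N => continuous f
  | k'.+1 => continuous f /\ forall i,
      (forall x, derivable f x (basis_vec i)) /\ class_C k' (partial f i)
  end.

Definition gradient V (x : 'rV[R]_d) : 'rV[R]_d := \row_i partial V i x.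

End calculus.

Section mollification.
Context (R : realType) (d : nat).
Implicit Types (b g : 'rV[R]_d -> R) (r : R).

Definition convolution b g (x : 'rV[R]_d) : R :=
  (\int[@lebesgue_rV R d]_y (b y * g (x - y)))%R.

Definition kappa (x : 'rV[R]_d) : R :=
  (volume (eball (0 : 'rV[R]_d) 1))^-1 * \1_(eball 0 1) x.

Definition kappa_ r (x : 'rV[R]_d) : R := r ^- d * kappa (r^-1 *: x).

Definition ball_average b (x : 'rV[R]_d) r : R :=
  (volume (eball x r))^-1 * (\int[@lebesgue_rV R d]_(y in eball x r) b y)%R.

End mollification.

Section dynamics.
Context (R : realType) (d : nat).
Local Notation phase := ('rV[R]_d * 'rV[R]_d)%type.
Implicit Types (V K b : 'rV[R]_d -> R) (phi : R -> phase -> phase) (rho : phase).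

Definition hamiltonian V rho : R := V rho.1 + 2^-1 * enorm rho.2 ^+ 2.

(* phi t rho is the point reached at time t from rho. *)
Definition is_hamiltonian_flow V phi : Prop :=
  forall rho, phi 0 rho = rho /\
    forall t : R,
      is_derive t 1 (fun s => (phi s rho).1) (phi t rho).2 /\
      is_derive t 1 (fun s => (phi s rho).2) (- gradient V (phi t rho).1).

Definition time_average (g : R -> R) (T : R) : R :=
  (2 * T)^-1 * (\int[lebesgue_measure]_(t in `[- T, T]) g t)%R.

Definition flow_average phi K (T : R) rho : R :=
  time_average (fun t => K (phi t rho).1) T.

(* limf_einf f F is the supremum over A in F of the infimum of f on A; level
   sets of the hamiltonian are nonempty for lambda large. *)
Definition dynamical_stabilization V phi b : Prop :=
  exists T r : R, [/\ 0 < T, 0 < r &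
    (0 < limf_einf (fun lambda : R =>
           ereal_inf [set (flow_average phi
               (convolution b (kappa_ (r / Num.sqrt lambda)))
               (T / lambda) rho)%:E
             | rho in [set rho | hamiltonian V rho = (lambda ^+ 2)%R]])
         (+oo_R)%R)%E].

Definition uniform_geometric_control b : Prop :=
  exists T c : R, [/\ 0 < T, 0 < c &
    forall x0 nu0 : 'rV[R]_d, enorm nu0 = 1 -> forall r : R, 0 < r ->
      c <= time_average (fun t => convolution b (kappa_ r) (x0 + t *: nu0)) T].

Definition turning_point_condition V b : Prop :=
  exists2 r : R, 0 < r &
    (0 < limf_einf (fun x : 'rV[R]_d =>
           (ball_average b x (r / (V x `^ (1 / 4))%R))%:E) at_infty)%E.

End dynamics.

(* Main.v *)
Require Import Defs.
From HB Require Import structures.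
From mathcomp Require Import all_boot all_order all_algebra.
From mathcomp Require Import all_classical all_reals all_analysis.
From mathcomp Require Import measurable_realfun ess_sup_inf ring lra.

(* All three conditions are bounds from below on the local averages
   [b * kappa_r], which are monotone up to constants: if [B_r(x)] lies in
   [B_s(y)] then [(b * kappa_r)(x) <= (s / r)^d (b * kappa_s)(y)].

   On the energy level [l^2] the growth condition gives [|grad V| = o(l^(3/2))],
   so during a time [T / l] the momentum moves by [o(sqrt l)] and the position
   deviates by [o(1 / sqrt l)] from the straight line [x + t xi]; this is
   negligible at the averaging scale [R / sqrt l].

   If [|xi| <= l], then [V] is comparable to [l^2] along the orbit and the turning
   point condition bounds every average on it from below. If [|xi| > l], the orbit
   follows a line over a length at least [T], and uniform geometric control
   applies.

   Conversely, orbits starting at rest stay within [O(1 / sqrt l)] of their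
   starting point, whence the turning point condition. For a line through [x0] and
   a radius [r], letting [l] be large compared with [V] near [x0] gives a bound for
   averages at a scale [p] much smaller than [r] along all parallel lines close to
   it; summing over a grid of disjoint [p]-balls inside [B_r(x0)] recovers the
   scale [r]. *)

Set Implicit Arguments.
Unset Strict Implicit.
Unset Printing Implicit Defensive.

Import Order.TTheory GRing.Theory Num.Theory.
Import numFieldNormedType.Exports.

Local Open Scope classical_set_scope.
Local Open Scope ring_scope.

(** * Euclidean balls and local averages *)

Section enorm.
Context {R : realType} {d : nat}.
Implicit Types (x y : 'rV[R]_d) (r : R).

Lemma enorm_ge0 x : 0 <= enorm x.
Proof. exact: sqrtr_ge0. Qed.

Lemma enorm_sqr x : enorm x ^+ 2 = \sum_i x ord0 i ^+ 2.
Proof. by rewrite sqr_sqrtr// sumr_ge0// => i _; rewrite sqr_ge0. Qed.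

Lemma enorm0 : enorm (0 : 'rV[R]_d) = 0.
Proof.
by rewrite /enorm big1 ?sqrtr0// => i _; rewrite mxE expr0n.
Qed.

Lemma enormZ r x : enorm (r *: x) = `|r| * enorm x.
Proof.
rewrite /enorm -sqrtr_sqr -sqrtrM ?sqr_ge0// mulr_sumr; congr Num.sqrt.
by apply: eq_bigr => i _; rewrite mxE exprMn.
Qed.

Lemma enormN x : enorm (- x) = enorm x.
Proof. by rewrite -scaleN1r enormZ normrN1 mul1r. Qed.

Lemma coord_le_enorm x i : `|x ord0 i| <= enorm x.
Proof.
rewrite -sqrtr_sqr ler_wsqrtr// (bigD1 i)//= lerDl.
by rewrite sumr_ge0// => j _; rewrite sqr_ge0.
Qed.

Lemma enorm_eq0 x : enorm x = 0 -> x = 0.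
Proof.
move=> x0; apply/rowP => i; rewrite mxE; apply/eqP.
by rewrite -normr_le0 -x0 coord_le_enorm.
Qed.

Lemma enormD x y : enorm (x + y) <= enorm x + enorm y.
Proof.
have [/enorm_eq0 ->|x0] := eqVneq (enorm x) 0; first by rewrite enorm0 !add0r.
have [/enorm_eq0 ->|y0] := eqVneq (enorm y) 0; first by rewrite enorm0 !addr0.
have {x0} x0 : 0 < enorm x by rewrite lt0r x0 enorm_ge0.
have {y0} y0 : 0 < enorm y by rewrite lt0r y0 enorm_ge0.
rewrite -(@ler_pXn2r _ 2)// ?nnegrE ?addr_ge0 ?enorm_ge0// enorm_sqr.
have -> : (enorm x + enorm y) ^+ 2 = \sum_i ((enorm x + enorm y) *
    (x ord0 i ^+ 2 / enorm x + y ord0 i ^+ 2 / enorm y)).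
  rewrite -mulr_sumr big_split/= -!mulr_suml -!enorm_sqr.
  by field; rewrite !gt_eqF.
(* Convexity of the square, with weights proportional to the two norms. *)
apply: ler_sum => i _; rewrite mxE -subr_ge0.
have -> : (enorm x + enorm y) * (x ord0 i ^+ 2 / enorm x + y ord0 i ^+ 2 / enorm y)
    - (x ord0 i + y ord0 i) ^+ 2 =
    (enorm y * x ord0 i - enorm x * y ord0 i) ^+ 2 / (enorm x * enorm y).
  by field; rewrite !gt_eqF.
by rewrite divr_ge0 ?sqr_ge0// mulr_ge0// ltW.
Qed.

Lemma enorm_le_cst x (e : R) : (forall i, `|x ord0 i| <= e) -> enorm x <= d%:R * e.
Proof.
move=> xe.
(* For [d = 0] the hypothesis on the coordinates is empty and says nothing about the sign of [e];
   both sides are then 0. *)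
have [d0|d0] := posnP d.
  rewrite /enorm big1 ?sqrtr0 ?d0 ?mul0r// => i _.
  by move: (ltn_ord i); rewrite {2}d0.
have e0 : 0 <= e by exact: le_trans (xe (Ordinal d0)).
rewrite -(@ler_pXn2r _ 2)// ?nnegrE ?enorm_ge0 ?mulr_ge0// enorm_sqr.
apply: (@le_trans _ _ (\sum_(i < d) e ^+ 2)).
  apply: ler_sum => i _; rewrite -real_normK ?num_real//.
  by rewrite ler_pXn2r ?nnegrE.
rewrite sumr_const card_ord -[X in X <= _]mulr_natl exprMn ler_wpM2r ?sqr_ge0//.
by rewrite expr2 ler_peMr// ler1n.
Qed.

Lemma eball_subset x y r s : enorm (x - y) + r <= s -> eball x r `<=` eball y s.
Proof.
move=> xyrs z /= xz; apply: lt_le_trans xyrs.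
have -> : z - y = (z - x) + (x - y) by rewrite addrA subrK.
by apply: le_lt_trans (enormD _ _) _; rewrite addrC ltrD2l.
Qed.

Lemma measurable_enormB x :
  measurable_fun [set: 'rV[R]_d] (fun y => enorm (y - x) : measurableTypeR R).
Proof.
pose f y : measurableTypeR R := \sum_i (y ord0 i - x ord0 i) ^+ 2.
have -> : (fun y : 'rV[R]_d => enorm (y - x)) = Num.sqrt \o f.
  apply/funext => y; rewrite /f /enorm /=; congr Num.sqrt.
  by apply: eq_bigr => i _; rewrite !mxE.
apply: measurableT_comp; last first.
  apply: measurable_sum => i; apply: measurable_funX; apply: measurable_funB => //.
  exact: measurable_coord_rV.
by apply: continuous_measurable_fun; exact: sqrt_continuous.
Qed.

Lemma measurable_eball x r : measurable (eball x r).
Proof.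
have -> : eball x r = setT `&` (fun y => enorm (y - x)) @^-1` `]-oo, r[.
  by rewrite setTI; apply/seteqP; split=> y /=; rewrite in_itv.
by apply: measurable_enormB => //; exact: measurable_itv.
Qed.

(** The measure of a cube is a product of interval lengths. Comparing a ball with the cube of
    half-side [r] around it and the cube of half-side [r / d] inside it bounds its volume on both
    sides by multiples of [r ^+ d]. *)
Let cube x r : set 'rV[R]_d :=
  [set y | forall i, `](x ord0 i - r), (x ord0 i + r)[%classic (y ord0 i)].

Lemma measurable_cube x r : measurable (cube x r).
Proof.
have -> : cube x r = \bigcap_(i in [set: 'I_d])
    (setT `&` (fun y => y ord0 i) @^-1` `](x ord0 i - r), (x ord0 i + r)[).
  apply/seteqP; split=> y /= xy i; first by move=> _; split=> //; exact: xy.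
  by have [] := xy i Logic.I.
apply: fin_bigcap_measurable => // i _.
by apply: measurable_coord_rV => //; exact: measurable_itv.
Qed.

Lemma lebesgue_cube x r : 0 <= r -> lebesgue_rV (cube x r) = ((2 * r) ^+ d)%:E.
Proof.
move=> r0; rewrite /cube.
rewrite (@lebesgue_rV_box R d (fun i => `](x ord0 i - r), (x ord0 i + r)[%classic));
  last by move=> i; exact: measurable_itv.
rewrite (eq_bigr (fun=> (2 * r)%:E)) => [|i _]; last first.
  rewrite lebesgue_measure_itv/= lte_fin; case: ltP => xr.
    by rewrite EFinN EFinD -EFinB; congr (_%:E); ring.
  by congr (_%:E); lra.
by rewrite prodEFin prodr_const card_ord.
Qed.

Lemma lebesgue_eball_le x r : 0 <= r -> (lebesgue_rV (eball x r) <= ((2 * r) ^+ d)%:E)%E.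
Proof.
move=> r0; rewrite -(lebesgue_cube x)//; apply: le_measure.
- by rewrite inE; exact: measurable_eball.
- by rewrite inE; exact: measurable_cube.
move=> y /= xy i; rewrite /= in_itv/=.
have := le_lt_trans (coord_le_enorm (y - x) i) xy; rewrite !mxE ltr_norml.
by case/andP => ? ?; apply/andP; split; lra.
Qed.

Lemma lebesgue_eball_ge x r : (0 < d)%N -> 0 <= r ->
  (((2 * (r / d%:R)) ^+ d)%:E <= lebesgue_rV (eball x r))%E.
Proof.
move=> d0 r0; rewrite -(lebesgue_cube x) ?divr_ge0//; apply: le_measure.
- by rewrite inE; exact: measurable_cube.
- by rewrite inE; exact: measurable_eball.
move=> y /= xy.
have xy' i : `|(y - x) ord0 i| < r / d%:R.
  by have := xy i; rewrite /= in_itv/= !mxE ltr_norml => /andP[? ?]; apply/andP; split; lra.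
(* [enorm_le_cst] yields only a weak inequality. Strictness comes from the largest coordinate, a
   maximum of finitely many numbers below [r / d]. *)
pose e := \big[Num.max/0]_i `|(y - x) ord0 i|.
apply: (@le_lt_trans _ _ (d%:R * e)).
  by apply: enorm_le_cst => i; rewrite /e; exact: le_bigmax.
rewrite mulrC -ltr_pdivlMr ?ltr0n// /e; apply/bigmax_ltP; split => //.
exact: (le_lt_trans (normr_ge0 _) (xy' (Ordinal d0))).
Qed.

Lemma volumeE x r : 0 <= r -> (volume (eball x r))%:E = lebesgue_rV (eball x r).
Proof.
move=> r0; rewrite /volume fineK// ge0_fin_numE; last exact: measure_ge0.
by apply: le_lt_trans (lebesgue_eball_le x r0) _; rewrite ltry.
Qed.

Lemma volume_le x r : 0 <= r -> volume (eball x r) <= (2 * r) ^+ d.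
Proof. by move=> r0; rewrite -lee_fin volumeE// lebesgue_eball_le. Qed.

Lemma volume_ge x r : (0 < d)%N -> 0 <= r ->
  (2 * (r / d%:R)) ^+ d <= volume (eball x r).
Proof. by move=> d0 r0; rewrite -lee_fin volumeE// lebesgue_eball_ge. Qed.

Lemma volume_gt0 x r : (0 < d)%N -> 0 < r -> 0 < volume (eball x r).
Proof.
move=> d0 r0; apply: lt_le_trans (volume_ge x d0 (ltW r0)).
by rewrite exprn_gt0// mulr_gt0// divr_gt0// ltr0n.
Qed.

Lemma coord_le_norm x i : `|x ord0 i| <= `|x|.
Proof.
rewrite [leRHS]/Num.Def.normr/= mx_normrE.
exact: (le_bigmax _ (fun ij => `|x ij.1 ij.2|) (ord0, i)).
Qed.

Lemma enorm_le_norm x : enorm x <= d%:R * `|x|.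
Proof. by apply: enorm_le_cst => i; exact: coord_le_norm. Qed.

Lemma near_enorm {T : topologicalType} (f : T -> 'rV[R]_d) (t : T) (e : R) :
  {for t, continuous f} -> 0 < e -> \forall s \near t, enorm (f s - f t) < e.
Proof.
(* The tolerance passes from the sup norm to the Euclidean one; [d.+1] keeps the divisor positive
   when [d = 0]. *)
move=> cf e0; have e0' : 0 < e / d.+1%:R by rewrite divr_gt0// ltr0n.
move/cvgrPdist_lt : cf => /(_ _ e0'); apply: filterS => s.
rewrite ltr_pdivlMr ?ltr0n// distrC => fse.
apply: le_lt_trans (enorm_le_norm _) _; apply: le_lt_trans fse.
by rewrite mulrC ler_wpM2l// ler_nat.
Qed.

End enorm.

(** * Masses of balls and mollified averages *)

Section mass.
Context {R : realType} {d : nat} (b : 'rV[R]_d -> R).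
Hypothesis d_gt0 : (0 < d)%N.
Hypothesis mb : measurable_fun [set: 'rV[R]_d] b.
Hypothesis b_ge0 : {ae @lebesgue_rV R d, forall x, 0 <= b x}.
Variable M : R.
Hypothesis b_leM : {ae @lebesgue_rV R d, forall x, b x <= M}.
Implicit Types (x y : 'rV[R]_d) (r s : R).

Let mu := @lebesgue_rV R d.

(** A representative of [b] whose bounds hold everywhere instead of almost everywhere. Its integrals
    over balls are those of [b], and monotonicity and additivity in the domain become available for
    them as extended reals. *)
Let b0 x := Num.max 0 (Num.min (Num.max 0 M) (b x)).

Let b0_ge0 x : 0 <= b0 x.
Proof. by rewrite /b0 le_max lexx. Qed.

Let b0_le x : b0 x <= Num.max 0 M.
Proof. by rewrite /b0 ge_max ge_min lexx/= le_max lexx. Qed.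

Let mb0 : measurable_fun [set: 'rV[R]_d] b0.
Proof.
apply: measurable_maxr => //; apply: measurable_minr => //.
Qed.

Let b0E : {ae mu, forall x, b x = b0 x}.
Proof.
apply: filterS2 b_ge0 b_leM => x bx0 bxM.
by rewrite /b0 min_r ?le_max ?bxM ?orbT// max_r.
Qed.

Let nu A := (\int[mu]_(y in A) (b0 y)%:E)%E.

Let nu_le A B : measurable A -> measurable B -> A `<=` B -> (nu A <= nu B)%E.
Proof.
move=> mA mB AB; apply: ge0_subset_integral => //.
  by apply/measurable_EFinP; exact: measurable_funTS.
by move=> x _; rewrite lee_fin.
Qed.

Let nu_eball x r : 0 <= r -> (nu (eball x r) <= (Num.max 0 M * (2 * r) ^+ d)%:E)%E.
Proof.
move=> r0; apply: (@le_trans _ _ (\int[mu]_(y in eball x r) (Num.max 0 M)%:E)%E).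
  apply: ge0_le_integral => //; try exact: measurable_eball.
  - by move=> y _; rewrite lee_fin.
  - by apply/measurable_EFinP; exact: measurable_funTS.
  - by move=> y _; rewrite lee_fin.
rewrite integral_cst; last exact: measurable_eball.
by rewrite EFinM lee_wpmul2l ?lee_fin ?le_max ?lexx// lebesgue_eball_le.
Qed.

Definition mass x r := (\int[mu]_(y in eball x r) b y)%R.

Let massE x r : 0 <= r -> (mass x r)%:E = nu (eball x r).
Proof.
move=> r0; have -> : mass x r = fine (nu (eball x r)).
  rewrite /mass /Rintegral /nu; congr fine; apply: ae_eq_integral.
  - exact: measurable_eball.
  - by apply/measurable_EFinP; exact: measurable_funTS.
  - by apply/measurable_EFinP; exact: measurable_funTS.
  - by apply: filterS b0E => y -> _.
rewrite fineK// ge0_fin_numE; first exact: le_lt_trans (nu_eball x r0) (ltry _).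
by apply: integral_ge0 => y _; rewrite lee_fin.
Qed.

Lemma mass_ge0 x r : 0 <= r -> 0 <= mass x r.
Proof.
move=> r0; rewrite -lee_fin massE//.
by apply: integral_ge0 => y _; rewrite lee_fin.
Qed.

Lemma mass_bounded x r : 0 <= r -> mass x r <= Num.max 0 M * (2 * r) ^+ d.
Proof. by move=> r0; rewrite -lee_fin massE// nu_eball. Qed.

Lemma sum_mass_le (I : finType) (x : I -> 'rV[R]_d) y r s : 0 <= r -> 0 <= s ->
  (forall i, eball (x i) r `<=` eball y s) ->
  (forall i j, i != j -> eball (x i) r `&` eball (x j) r = set0) ->
  \sum_i mass (x i) r <= mass y s.
Proof.
move=> r0 s0 xy xx; rewrite -lee_fin massE// -sumEFin.
under eq_bigr do rewrite massE//.
rewrite -ge0_integral_bigsetU//.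
- apply: nu_le.
  + by apply: bigsetU_measurable => i _; exact: measurable_eball.
  + exact: measurable_eball.
  + by rewrite -bigcup_seq => z [i _]; exact: xy.
- by move=> i; exact: measurable_eball.
- exact: index_enum_uniq.
- apply/trivIsetP => i j _ _; exact: xx.
- by apply/measurable_EFinP; exact: measurable_funTS.
- by move=> z _; rewrite lee_fin.
Qed.

(** The concentric balls of radius [r - 1 / (n + 1)] exhaust the open ball, so one of them already
    has mass above [a]. That ball stays inside [eball y r] as long as [y] is within [1 / (n + 1)] of
    [x]. *)
Lemma mass_lsc x r (a : R) : 0 < r -> a < mass x r ->
  exists2 e, 0 < e & forall y, enorm (y - x) < e -> a < mass y r.
Proof.
move=> r0 am; have ax : (a%:E < nu (eball x r))%E by rewrite -(massE x (ltW r0)) lte_fin.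
pose F n := eball x (r - n.+1%:R^-1).
have UF : \bigcup_n F n = eball x r.
  apply/seteqP; split=> [y [n _]|y xy]; rewrite /F /eball/=.
    by move/lt_le_trans; apply; rewrite gerBl invr_ge0.
  have : 0 < r - enorm (y - x) by rewrite subr_gt0.
  move=> /ltr_add_invr[k].
  rewrite add0r => kr; exists k => //=.
  by rewrite ltrBrDl -ltrBrDr.
have : (nu \o F) n @[n --> \oo] --> nu (eball x r).
  rewrite -UF; apply: ge0_nondecreasing_set_cvg_integral.
  - apply/nondecreasing_seqP => n; rewrite subsetEset => y.
    rewrite /F /eball/= => /lt_le_trans; apply.
    by rewrite lerD2l lerN2 lef_pV2 ?posrE ?ltr0n// ler_nat.
  - by move=> n; exact: measurable_eball.
  - by move=> n; apply/measurable_EFinP; exact: measurable_funTS.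
  - by move=> n y _; rewrite lee_fin.
move=> cF.
have [n an] : exists n, (a%:E < nu (F n))%E.
  apply: contrapT => /forallNP h.
  have := cvg_lim (@ereal_hausdorff R) cF => limF.
  have : (limn (nu \o F) <= a%:E)%E.
    apply: lime_le; first by apply/cvg_ex; exists (nu (eball x r)).
    by near=> n; rewrite leNgt; exact/negP/h.
  by rewrite limF leNgt ax.
exists n.+1%:R^-1; first by rewrite invr_gt0 ltr0n.
move=> y yx; rewrite -lte_fin (massE y (ltW r0)); apply: (lt_le_trans an).
apply: nu_le; [exact: measurable_eball|exact: measurable_eball|].
apply: eball_subset; rewrite -enormN opprB.
by rewrite addrCA gerDl subr_le0 ltW.
Unshelve. all: by end_near. Qed.

(** Lower semicontinuity survives composition with a continuous curve and already implies
    measurability. *)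
Lemma measurable_mass_curve (g : R -> 'rV[R]_d) r : 0 < r -> continuous g ->
  measurable_fun [set: R] (fun t => mass (g t) r : measurableTypeR R).
Proof.
move=> r0 cg; apply/measurable_EFinP; apply: lower_semicontinuous_measurable.
move=> t a at_lt; have ag : a < mass (g t) r by rewrite -lte_fin.
have [e e0 eP] := mass_lsc r0 ag.
exists [set s | enorm (g s - g t) < e].
  exact: (@near_enorm _ _ R g t e (cg t) e0).
by move=> s /eP; rewrite lte_fin.
Qed.

Definition mollified r x := convolution b (kappa_ r) x.

Lemma mollifiedE x r : 0 < r ->
  mollified r x = (r ^- d * (volume (eball (0 : 'rV[R]_d) 1))^-1) * mass x r.
Proof.
move=> r0; have r1 : 0 <= r by exact: ltW.
set c := r ^- d * _.
have eballE y : (y \in eball x r) = (r^-1 *: (x - y) \in eball (0 : 'rV[R]_d) 1).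
  apply/idP/idP; rewrite !inE /eball/= subr0 enormZ gtr0_norm ?invr_gt0//;
  by rewrite mulrC ltr_pdivrMr// mul1r -enormN opprB.
have kE y : b y * kappa_ r (x - y) = (fun z => c * (b \_ (eball x r)) z) y.
  rewrite /kappa_ /kappa indicE -eballE patchE /c /=.
  by case: (y \in eball x r); rewrite ?mulr1 ?mulr0// mulrC.
have mB := measurable_eball x r.
have mbB : measurable_fun (eball x r) (EFin \o b).
  by apply/measurable_EFinP; exact: measurable_funTS.
rewrite /mollified /convolution.
rewrite (@eq_Rintegral _ _ _ mu setT (fun z => c * (b \_ (eball x r)) z)) => [|y _]; last exact: kE.
rewrite RintegralZl//; first by rewrite /mass [in RHS]Rintegral_mkcond.
rewrite -restrict_EFin; apply/(integrable_mkcond _ _).1 => //.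
apply/integrableP; split => //.
have -> : (\int[mu]_(y in eball x r) `|(EFin \o b) y| = nu (eball x r))%E.
  apply: ae_eq_integral => //.
  - exact: measurableT_comp.
  - by apply/measurable_EFinP; exact: measurable_funTS.
  - by apply: filterS b0E => y by0 _ /=; rewrite by0 ger0_norm.
by apply: le_lt_trans (nu_eball x r1) _; rewrite ltry.
Qed.

Let unit_volume_gt0 : 0 < volume (eball (0 : 'rV[R]_d) 1).
Proof. exact: volume_gt0. Qed.

Lemma mollified_ge0 r x : 0 < r -> 0 <= mollified r x.
Proof.
move=> r0; rewrite mollifiedE// mulr_ge0// ?mass_ge0 ?ltW//.
by rewrite mulr_gt0// invr_gt0// exprn_gt0.
Qed.

Lemma mollified_bounded r : 0 < r -> exists C, forall x, mollified r x <= C.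
Proof.
move=> r0; eexists => x; rewrite mollifiedE//; apply: ler_wpM2l.
  by rewrite mulr_ge0// invr_ge0 ?exprn_ge0// ltW.
by apply: mass_bounded; rewrite ltW.
Qed.

(** Masses of disjoint balls add up inside the large one; [(s / r) ^+ d] is the quotient of the two
    normalisations. *)
Lemma sum_mollified_le (I : finType) (x : I -> 'rV[R]_d) y r s : 0 < r -> 0 < s ->
  (forall i, eball (x i) r `<=` eball y s) ->
  (forall i j, i != j -> eball (x i) r `&` eball (x j) r = set0) ->
  \sum_i mollified r (x i) <= (s / r) ^+ d * mollified s y.
Proof.
move=> r0 s0 xy xx; under eq_bigr do rewrite mollifiedE//.
rewrite -mulr_sumr mollifiedE// expr_div_n.
rewrite (_ : _ * (_ * mass y s) =
  r ^- d / volume (eball (0 : 'rV[R]_d) 1) * mass y s); last first.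
  by field; rewrite !gt_eqF// exprn_gt0.
apply: ler_wpM2l; first by rewrite mulr_ge0// invr_ge0 ?exprn_ge0// ltW.
by apply: sum_mass_le => //; rewrite ltW.
Qed.

Lemma le_mollified r s x y : 0 < r -> enorm (x - y) + r <= s ->
  mollified r x <= (s / r) ^+ d * mollified s y.
Proof.
move=> r0 xyrs.
have s0 : 0 < s by apply: lt_le_trans xyrs; rewrite ltr_wpDl ?enorm_ge0.
have := @sum_mollified_le 'I_1 (fun=> x) y r s r0 s0.
rewrite big_ord_recl big_ord0 addr0; apply=> [_|i j]; first exact: eball_subset.
by rewrite !ord1 eqxx.
Qed.

Lemma measurable_mollified_curve (g : R -> 'rV[R]_d) r : 0 < r -> continuous g ->
  measurable_fun [set: R] (fun t => mollified r (g t) : measurableTypeR R).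
Proof.
move=> r0 cg; under eq_fun do rewrite mollifiedE//.
by apply: measurable_funM => //; exact: measurable_mass_curve.
Qed.

(** The ball average divides by the volume of [eball x r], the mollification by [r ^+ d] times the
    unit volume. The cube bounds keep the quotient of these between constants independent of [x] and
    [r], which is enough for the positivity of a lower limit. *)
Lemma ball_average_mollified : exists2 m : R * R, 0 < m.1 /\ 0 < m.2 &
  forall x r, 0 < r ->
    m.1 * mollified r x <= ball_average b x r <= m.2 * mollified r x.
Proof.
set v := volume (eball (0 : 'rV[R]_d) 1).
exists (v / 2 ^+ d, v / (2 / d%:R) ^+ d).
  by split=> /=; rewrite divr_gt0// exprn_gt0// divr_gt0// ltr0n.
move=> x r r0; have r1 := ltW r0.
have V0 : 0 < volume (eball x r) by exact: volume_gt0.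
rewrite mollifiedE// -/v /ball_average -/(mass x r) /=.
have d0 : 0 < d%:R :> R by rewrite ltr0n.
have -> : v / 2 ^+ d * (r ^- d / v * mass x r) = ((2 * r) ^+ d)^-1 * mass x r.
  by rewrite exprMn; field; rewrite !gt_eqF ?exprn_gt0.
have -> : v / (2 / d%:R) ^+ d * (r ^- d / v * mass x r) =
    ((2 * (r / d%:R)) ^+ d)^-1 * mass x r.
  by rewrite !(exprMn, expr_div_n); field; rewrite !gt_eqF ?exprn_gt0 ?invr_gt0.
apply/andP; split; apply: ler_wpM2r; rewrite ?mass_ge0// lef_pV2 ?posrE//.
- exact: volume_le.
- by rewrite exprn_gt0// mulr_gt0.
- exact: volume_ge.
- by rewrite exprn_gt0// mulr_gt0// divr_gt0.
Qed.

End mass.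

(** * Time averages *)

Section time_average.
Context {R : realType}.
Implicit Types (g h : R -> R) (T s c : R).

Let mu := @lebesgue_measure R.

(** The class of integrands of all time averages: integrable on segments and stable under
    non-negative multiples, finite sums and dilations of time. *)
Definition bounded_measurable g :=
  measurable_fun [set: R] g /\ exists C, forall t, 0 <= g t <= C.

Lemma bounded_measurable_integrable g (a b : R) : bounded_measurable g ->
  mu.-integrable `[a, b] (EFin \o g).
Proof.
move=> [mg [C gC]]; apply: measurable_bounded_integrable => //.
- by rewrite /= lebesgue_measure_itv; case: ifPn => //= _; rewrite ltry.
- exact: measurable_funTS.
- exists C; split; first exact: num_real.
  by move=> x Cx t _ /=; have /andP[g0 gc] := gC t; rewrite ger0_norm//; lra.
Qed.

Lemma bounded_measurable_cst c : 0 <= c -> bounded_measurable (fun=> c).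
Proof. by move=> c0; split=> //; exists c => t; rewrite c0 lexx. Qed.

Lemma bounded_measurableZ c g : 0 <= c -> bounded_measurable g ->
  bounded_measurable (fun t => c * g t).
Proof.
move=> c0 [mg [C gC]]; split; first exact: measurable_funM.
exists (c * C) => t; have /andP[g0 gc] := gC t.
by rewrite mulr_ge0// ler_wpM2l.
Qed.

Lemma bounded_measurable_sum (I : Type) (r : seq I) (g : I -> R -> R) :
  (forall i, bounded_measurable (g i)) ->
  bounded_measurable (fun t => \sum_(i <- r) g i t).
Proof.
move=> bg; elim: r => [|i r IHr].
  by under eq_fun do rewrite big_nil; exact: bounded_measurable_cst.
under eq_fun do rewrite big_cons.
have [[mg [C gC]] [mh [D hD]]] := (bg i, IHr).
split; first exact: measurable_funD.
exists (C + D) => t; have [/andP[? ?] /andP[? ?]] := (gC t, hD t).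
by rewrite addr_ge0// lerD.
Qed.

Lemma bounded_measurable_scale s g : bounded_measurable g ->
  bounded_measurable (fun t => g (s * t)).
Proof.
move=> [mg [C gC]]; split; last by exists C.
by apply: measurableT_comp => //; exact: mulrl_measurable.
Qed.

Lemma le_time_average g h T : 0 < T -> bounded_measurable g -> bounded_measurable h ->
  (forall t, `|t| <= T -> g t <= h t) -> time_average g T <= time_average h T.
Proof.
move=> T0 bg bh gh; rewrite /time_average ler_wpM2l//.
  by rewrite invr_ge0 mulr_ge0// ltW.
apply: le_Rintegral => //; try exact: bounded_measurable_integrable.
by move=> t /=; rewrite in_itv/= -ler_norml; exact: gh.
Qed.

Lemma time_average_cst c T : 0 < T -> time_average (fun=> c) T = c.
Proof.
move=> T0; rewrite /time_average Rintegral_cst//=.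
rewrite lebesgue_measure_itv/= lte_fin gtrN// EFinN -EFinB/=.
by field; rewrite gt_eqF.
Qed.

Lemma time_averageZ c g T : bounded_measurable g ->
  time_average (fun t => c * g t) T = c * time_average g T.
Proof.
move=> bg; rewrite /time_average RintegralZl//; first by rewrite mulrCA.
exact: bounded_measurable_integrable.
Qed.

Lemma time_averageD g h T : bounded_measurable g -> bounded_measurable h ->
  time_average (fun t => g t + h t) T = time_average g T + time_average h T.
Proof.
move=> bg bh; rewrite /time_average RintegralD ?mulrDr//;
exact: bounded_measurable_integrable.
Qed.

Lemma time_average_sum (I : Type) (r : seq I) (g : I -> R -> R) T : 0 < T ->
  (forall i, bounded_measurable (g i)) ->
  time_average (fun t => \sum_(i <- r) g i t) T = \sum_(i <- r) time_average (g i) T.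
Proof.
move=> T0 bg; elim: r => [|i r IHr].
  rewrite big_nil -[RHS](time_average_cst 0 T0); congr time_average.
  by apply/funext => t; rewrite big_nil.
rewrite big_cons -IHr -time_averageD//; last exact: bounded_measurable_sum.
by congr time_average; apply/funext => t; rewrite big_cons.
Qed.

(** [T * time_average g T] is half the integral over the window, and the integral of a non-negative
    function grows with the window. *)
Lemma time_average_widen g T T' : 0 < T -> T <= T' -> bounded_measurable g ->
  T * time_average g T <= T' * time_average g T'.
Proof.
move=> T0 TT' bg; have T'0 := lt_le_trans T0 TT'.
have e S : 0 < S -> S * time_average g S = 2^-1 * \int[mu]_(t in `[- S, S]) g t.
  by move=> S0; rewrite /time_average; field; rewrite gt_eqF.
rewrite !e// ler_wpM2l ?invr_ge0// /Rintegral.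
have [mg [C gC]] := bg.
have mgE D : measurable_fun D (fun t : measurableTypeR R => (g t)%:E).
  by apply/measurable_EFinP; exact: measurable_funTS.
have g0 t : (0 <= (g t)%:E)%E by have /andP[] := gC t; rewrite lee_fin.
apply: fine_le.
- by apply: (integrable_fin_num _ (bounded_measurable_integrable _ _ bg)).
- by apply: (integrable_fin_num _ (bounded_measurable_integrable _ _ bg)).
- apply: ge0_subset_integral => // t /=; rewrite !in_itv/= => /andP[? ?].
  by apply/andP; split; lra.
Qed.

(** Lebesgue measure is [s] times its pushforward under multiplication by [s], because the two agree
    on half-open intervals. *)
Let integral_scale s g (D : set R) : 0 < s -> measurable D ->
  measurable_fun [set: R] g -> (forall t, 0 <= g t) ->
  (\int[mu]_(t in D) (g t)%:E = s%:E * \int[mu]_(t in *%R s @^-1` D) (g (s * t))%:E)%E.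
Proof.
move=> s0 mD mg g0.
pose f : measurableTypeR R -> measurableTypeR R := *%R s.
have mf : measurable_fun setT f by exact: mulrl_measurable.
pose nu : {measure set (measurableTypeR R) -> \bar R} :=
  measure_function_pushforward__canonical__measure_function_Measure mu mf.
pose m : {measure set (measurableTypeR R) -> \bar R} := mscale (NngNum (ltW s0)) nu.
have mE A : measurable A -> mu A = m A.
  apply: lebesgue_measure_unique => _ [[a b] _ <-] /=.
  rewrite /m /mscale /= /pushforward.
  rewrite (_ : f @^-1` _ = `](a / s), (b / s)]%classic); last first.
    apply/seteqP; split => x /=; rewrite !in_itv/= ler_pdivlMr// ltr_pdivrMr//;
    by rewrite /f mulrC.
  rewrite !lebesgue_measure_itv/= !lte_fin ltr_pM2r ?invr_gt0//.
  case: ifPn => _; last by rewrite mule0.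
  by rewrite -!EFinB -EFinM; congr (_%:E); field; rewrite gt_eqF.
have mgE E : measurable_fun E (fun t : measurableTypeR R => (g t)%:E).
  by apply/measurable_EFinP; exact: measurable_funTS.
rewrite (@eq_measure_integral _ (measurableTypeR R) _ D m); last by move=> A mA _; exact: mE.
rewrite ge0_integral_mscale//; last by move=> t _; rewrite lee_fin.
rewrite ge0_integral_pushforward//.
by move=> t _; rewrite lee_fin.
Qed.

Lemma time_average_scale s g T : 0 < s -> bounded_measurable g ->
  time_average (fun t => g (s * t)) T = time_average g (s * T).
Proof.
move=> s0 [mg [C gC]]; rewrite /time_average /Rintegral (@integral_scale s g)//; last first.
  by move=> t; have /andP[] := gC t.
rewrite (_ : *%R s @^-1` _ = `[- T, T]%classic); last first.
  apply/seteqP; split => t /=; rewrite !in_itv/= -mulrN !ler_pM2l//.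
rewrite -/mu [s * T]mulrC mulrA [in RHS]invfM.
have := @bounded_measurable_integrable (fun t => g (s * t)) (- T) T.
move=> /(_ (bounded_measurable_scale _ (conj mg (ex_intro _ C gC)))) /integrable_fin_num.
move=> /(_ (measurable_itv _)) fi.
by rewrite fineM//= [in RHS]mulrA [_ / s * s]divfK ?gt_eqF.
Qed.

End time_average.

(** * The Hamiltonian flow at high energy *)

Section calculus.
Context {R : realType} {d : nat}.
Implicit Types (x y h v : 'rV[R]_d) (V : 'rV[R]_d -> R).

(** Treats both signs of [a] at once, for use with negative times and negative coordinate
    increments. *)
Lemma mean_value (g g' : R -> R) (a : R) :
  (forall t : R, `|t| <= `|a| -> is_derive t 1 g (g' t)) ->
  exists2 t, `|t| <= `|a| & g a - g 0 = g' t * a.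
Proof.
move=> dg.
have cg (u w : R) : - `|a| <= u -> w <= `|a| -> {within `[u, w], continuous g}.
  move=> au va; apply: derivable_within_continuous => t.
  rewrite in_itv/= => /andP[ut tv].
  have ta : `|t| <= `|a| by rewrite ler_norml; apply/andP; split; lra.
  by case: (dg _ ta).
have [a0|a0] := leP 0 a.
  have [| |t] := @MVT_segment R g g' 0 a a0.
  - move=> t; rewrite in_itv/= => /andP[? ?]; apply: dg.
    by rewrite !ger0_norm// ltW.
  - by apply: cg; rewrite ?oppr_le0// ler_norm.
  rewrite in_itv/= subr0 => /andP[t0 ta] e; exists t => //.
  by rewrite !ger0_norm.
have [| |t] := @MVT_segment R g g' a 0 (ltW a0).
- move=> t; rewrite in_itv/= => /andP[? ?]; apply: dg.
  by rewrite !ltr0_norm// lerN2 ltW.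
- by apply: cg => //; rewrite ltr0_norm// opprK.
rewrite in_itv/= sub0r => /andP[ta t0] e; exists t => //.
  by rewrite ler0_norm// ltr0_norm// lerN2.
by rewrite -opprB e mulrN opprK.
Qed.

Lemma is_derive_line V x v (s : R) : derivable V (x + s *: v) v ->
  is_derive s 1 (fun t => V (x + t *: v)) ('D_v V (x + s *: v)).
Proof.
move=> dV.
have e : (fun u : R => u^-1 *: (((fun t => V (x + t *: v)) \o shift s) (u *: (1 : R)) -
      V (x + s *: v))) =
    (fun u : R => u^-1 *: ((V \o shift (x + s *: v)) (u *: v) - V (x + s *: v))).
  apply/funext => u /=; congr (_ *: (V _ - _)).
  by rewrite /shift/= scalerDl /GRing.scale/= mulr1 addrCA.
by apply: DeriveDef; rewrite /derivable /derive e.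
Qed.

Definition C1 V :=
  forall i, (forall x, derivable V x (basis_vec R i)) /\ continuous (partial V i).

Lemma class_C2_C1 V : class_C 2 V -> C1 V.
Proof. by move=> [_ VC] i; have [? []] := VC i. Qed.

(** The points [x + head k h] are the vertices of a staircase that changes one coordinate at a
    time. *)
Let head k h : 'rV[R]_d := \row_i (if (i < k)%N then h ord0 i else 0).

(* The points [c i] lie on the edges of the staircase from [x] to [x + h] parallel
   to the axes. *)
Lemma mean_value_C1 V x h : C1 V -> exists c : 'I_d -> 'rV[R]_d,
  (forall i, `|c i - x| <= `|h|) /\
  V (x + h) - V x = \sum_i partial V i (c i) * h ord0 i.
Proof.
move=> VC1.
have step (i : 'I_d) : exists c, `|c - x| <= `|h| /\
    V (x + head i.+1 h) - V (x + head i h) = partial V i c * h ord0 i.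
  have [t th e] := @mean_value (fun t => V (x + head i h + t *: basis_vec R i))
    (fun t => partial V i (x + head i h + t *: basis_vec R i)) (h ord0 i)
    (fun t _ => is_derive_line ((VC1 i).1 _)).
  exists (x + head i h + t *: basis_vec R i); split.
    rewrite -[_ + _ + t *: _]addrA [x + _]addrC addrK [leLHS]/Num.Def.normr/= mx_normrE.
    apply: bigmax_le => // -[j k] _ /=; rewrite !mxE.
    have -> : j == ord0 by rewrite ord1.
    rewrite /=.
    case: ltnP => ki.
      rewrite (_ : _ == _ = false) ?mulr0 ?addr0 ?coord_le_norm//.
      by apply/eqP => ki'; rewrite ki' ltnn in ki.
    rewrite add0r; case: eqP => [_|_]; last by rewrite mulr0 normr0.
    by rewrite mulr1; apply: le_trans th _; exact: coord_le_norm.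
  rewrite -e scale0r addr0 -addrA; congr (V (_ + _) - _).
  apply/rowP => j; rewrite !mxE eqxx /= ltnS leq_eqVlt.
  have [->|ji] := eqVneq j i; first by rewrite eqxx ltnn mulr1 add0r.
  by rewrite (_ : (j == i :> nat) = false)//= ?mulr0 ?addr0//; apply/negbTE.
pose c i := sval (cid (step i)).
exists c; split=> [i|]; first by have [] := svalP (cid (step i)).
under eq_bigr do rewrite -(svalP (cid (step _))).2.
rewrite -(big_mkord xpredT (fun i => V (x + head i.+1 h) - V (x + head i h))).
rewrite telescope_sumr//; congr (V (_ + _) - V _).
  by apply/rowP => j; rewrite mxE ltn_ord.
by rewrite (_ : head 0 h = 0) ?addr0//; apply/rowP => j; rewrite !mxE.
Qed.

Lemma is_derive_coord (g : R -> 'rV[R]_d) (t : R) v i : is_derive t 1 g v ->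
  is_derive t 1 (fun s => g s ord0 i) (v ord0 i).
Proof.
move=> [dg <-]; apply: DeriveDef; first by move/derivable_mxP : dg; exact.
by rewrite derive_mx// mxE.
Qed.

Lemma is_derive_continuous (g : R -> 'rV[R]_d) (t : R) v : is_derive t 1 g v ->
  {for t, continuous g}.
Proof. by move=> [dg _]; apply/differentiable_continuous/derivable1_diffP. Qed.

(** Chain rule from continuous partial derivatives. The increment of [V] is written with partials
    taken at points [c u i] no farther from [g t] than [g (t + u)] is. These points converge to
    [g t], so the partials converge by continuity. *)
Lemma is_derive_C1_curve V (g : R -> 'rV[R]_d) (t : R) v : C1 V ->
  is_derive t 1 g v ->
  is_derive t 1 (fun s => V (g s)) (\sum_i partial V i (g t) * v ord0 i).
Proof.
move=> VC1 dg.
pose D (u : R) := g (u *: (1 : R) + t) - g t.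
have /choice[c cP] : forall u, exists c : 'I_d -> 'rV[R]_d,
    (forall i, `|c i - g t| <= `|D u|) /\
    V (g t + D u) - V (g t) = \sum_i partial V i (c i) * D u ord0 i.
  by move=> u; exact: mean_value_C1.
have gt : g (u *: (1 : R) + t) @[u --> 0^'] --> g t.
  have cgt := is_derive_continuous dg.
  apply: (@cvg_comp _ _ _ (fun u : R => u *: (1 : R) + t) g _ (nbhs t)) => //.
  apply/cvgrPdist_lt => e e0; near=> u.
  rewrite opprD addrCA subrr addr0 /GRing.scale/= mulr1 normrN.
  by near: u; exact: dnbhs0_lt.
have cg i : c u i @[u --> 0^'] --> g t.
  apply/cvgrPdist_lt => e e0; move/cvgrPdist_lt : gt => /(_ e e0).
  apply: filterS => u; rewrite distrC => ge; rewrite distrC.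
  by apply: le_lt_trans ge; exact: (cP u).1.
have quot : (fun u : R => u^-1 *: (((fun s => V (g s)) \o shift t) (u *: (1 : R)) - V (g t))) @ 0^'
    --> \sum_i partial V i (g t) * v ord0 i.
  have -> : (fun u : R => u^-1 *: (((fun s => V (g s)) \o shift t) (u *: (1 : R)) - V (g t))) =
    (fun u => \sum_i (partial V i (c u i) * (u^-1 *: D u ord0 i))).
    apply/funext => u /=.
    rewrite /shift/= -[X in V (X)](subrKC (g t)) (cP u).2 scaler_sumr.
    by apply: eq_bigr => i _; rewrite /GRing.scale/= mulrCA.
  apply: cvg_big => [|i _]; first exact: add_continuous.
  apply: cvgM.
    by apply: (cvg_comp _ _ (cg i)); exact: (VC1 i).2.
  have [/cvg_ex[l dgl] <-] := is_derive_coord i dg.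
  rewrite [X in _ --> X](cvg_lim _ dgl)//.
  apply: cvg_trans dgl; apply: near_eq_cvg; near=> u.
  by rewrite /D /= !mxE.
apply: DeriveDef; first by apply/cvg_ex; eexists; exact: quot.
exact/cvg_lim.
Unshelve. all: by end_near. Qed.

End calculus.

(** * Smallness of the gradient below a high energy level *)

Section growth.
Context {R : realType} {d : nat}.
Implicit Types (f V : 'rV[R]_d -> R).

Lemma continuous_bounded_on_ball f (r : R) : continuous f ->
  exists C, forall x, enorm x <= r -> `|f x| <= C.
Proof.
move=> cf.
(* The ball lies in the cube of half-side [r], a product of compact segments. *)
have cK := @rV_compact R d (fun=> `[- r, r]%classic) (fun=> @segment_compact R _ _).
have /compact_bounded[M [_ MP]] := continuous_compact (continuous_subspaceT cf) cK.
exists (`|M| + 1) => x xr; apply: MP.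
  by rewrite ltr_pwDr// ler_norm.
exists x => // i /=; rewrite in_itv/= -ler_norml.
exact: le_trans (coord_le_enorm x i) xr.
Qed.

Lemma near_at_infty (P : set 'rV[R]_d) : (\forall x \near at_infty, P x) ->
  exists r, forall x, r < enorm x -> P x.
Proof.
move=> [r [_ rP]]; exists (r + 1) => x rx.
by apply: (rP (r + 1)) => //; rewrite ltrDl.
Qed.

(** Far away the growth condition bounds the gradient by [e] times the power 3/4 of [V], and
    [V x <= l ^+ 2] turns this into [e * (l * Num.sqrt l)]. On the remaining ball the partials are
    bounded by a constant, which a large [l] dominates. *)
Lemma small_gradient V : C1 V -> (forall x, 0 <= V x) ->
  (fun x => enorm (gradient V x)) =o_at_infty (fun x => V x `^ (3 / 4)) ->
  forall e : R, 0 < e -> exists2 l0, 0 < l0 & forall l x i, l0 <= l -> V x <= l ^+ 2 ->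
    `|partial V i x| <= e * (l * Num.sqrt l).
Proof.
move=> VC1 V0 /eqoP gradV e e0.
have /near_at_infty[r rP] := gradV _ e0.
have /choice[C CP] : forall i, exists C, forall x, enorm x <= r -> `|partial V i x| <= C.
  by move=> i; apply: continuous_bounded_on_ball; exact: (VC1 i).2.
pose S := \sum_i `|C i|.
have S0 : 0 <= S by apply: sumr_ge0.
(* The term [S / e] gives [S <= e * l] on the inner ball, and the 1 gives [1 <= Num.sqrt l]. *)
exists (1 + S / e); first by rewrite ltr_wpDr// divr_ge0// ltW.
move=> l x i l0l Vl.
have l1 : 1 <= l by apply: le_trans l0l; rewrite lerDl divr_ge0// ltW.
have l0 : 0 < l by exact: lt_le_trans l1.
have [xr|xr] := leP (enorm x) r.
  apply: le_trans (CP i x xr) _; apply: (@le_trans _ _ S).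
    by apply: le_trans (ler_norm _) _; rewrite /S (bigD1 i)//= lerDl sumr_ge0.
  apply: (@le_trans _ _ (e * l)).
    by rewrite mulrC -ler_pdivrMr//; apply: le_trans l0l; rewrite lerDr.
  by rewrite ler_pM2l// ler_peMr ?(ltW l0)// -sqrtr1 ler_wsqrtr.
have := rP x xr; rewrite ger0_norm ?enorm_ge0// => grad.
have -> : partial V i x = gradient V x ord0 i by rewrite mxE.
apply: le_trans (coord_le_enorm _ _) _; apply: le_trans grad _.
rewrite ler_pM2l// ger0_norm ?powR_ge0//.
have -> : l * Num.sqrt l = (l ^+ 2) `^ (3 / 4).
  rewrite -powR12_sqrt ?(ltW l0)// -{1}(powRr1 (ltW l0)) -powRD; last first.
    by rewrite gt_eqF ?implybT.
  by rewrite -powR_mulrn ?(ltW l0)// -powRrM; congr (_ `^ _); field.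
by apply: ge0_ler_powR; rewrite ?nnegrE// ?exprn_ge0 ?(ltW l0)// divr_ge0.
Qed.

End growth.

(** * Energy conservation and nearly straight orbits *)

Section hamiltonian_flow.
Context {R : realType} {d : nat}.
Variables (V : 'rV[R]_d -> R)
  (phi : R -> 'rV[R]_d * 'rV[R]_d -> 'rV[R]_d * 'rV[R]_d).
Hypotheses (VC1 : C1 V) (V_ge0 : forall x, 0 <= V x).
Hypothesis phiV : is_hamiltonian_flow V phi.
Implicit Types rho : 'rV[R]_d * 'rV[R]_d.

Lemma flow0 rho : phi 0 rho = rho.
Proof. by have [] := phiV rho. Qed.

Lemma is_derive_position rho (t : R) i :
  is_derive t 1 (fun s => (phi s rho).1 ord0 i) ((phi t rho).2 ord0 i).
Proof. by have [_ /(_ t)[? _]] := phiV rho; exact: is_derive_coord. Qed.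

Lemma is_derive_momentum rho (t : R) i :
  is_derive t 1 (fun s => (phi s rho).2 ord0 i) (- partial V i (phi t rho).1).
Proof.
have [_ /(_ t)[_ /(is_derive_coord i)]] := phiV rho.
by rewrite !mxE.
Qed.

Lemma continuous_position rho : continuous (fun t => (phi t rho).1).
Proof. by move=> t; have [_ /(_ t)[? _]] := phiV rho; exact: is_derive_continuous. Qed.

(** By the chain rule the derivative along the orbit is a sum of terms
    [partial V i * xi i - xi i * partial V i], all zero. *)
Lemma energy_conservation rho t : hamiltonian V (phi t rho) = hamiltonian V rho.
Proof.
pose xi i s : R := (phi s rho).2 ord0 i.
pose E := (fun s => V (phi s rho).1) + 2^-1 \*: \sum_(i < d) (xi i * xi i).
have EE s : E s = hamiltonian V (phi s rho).
  rewrite /E /hamiltonian enorm_sqr; congr (_ + _ * _).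
  by rewrite fct_sumE; apply: eq_bigr => i _; rewrite expr2.
rewrite -EE -[in RHS](flow0 rho) -EE; apply: is_derive_0_is_cst => s.
have dx : is_derive s 1 (fun u => (phi u rho).1) (phi s rho).2.
  by have [_ /(_ s)[]] := phiV rho.
have dV := is_derive_C1_curve VC1 dx.
have dxi i : is_derive s 1 (xi i) (- partial V i (phi s rho).1).
  exact: is_derive_momentum.
have dS := is_derive_sum (fun i => is_deriveM (dxi i) (dxi i)).
have dE := is_deriveD dV (is_deriveZ 2^-1 dS).
apply: is_derive_eq dE _.
rewrite /GRing.scale/= mulr_sumr -big_split/= big1// => i _.
by rewrite /xi; field.
Qed.

Hypothesis gradV :
  (fun x => enorm (gradient V x)) =o_at_infty (fun x => V x `^ (3 / 4)).

(** Energy conservation keeps [V] below [l ^+ 2] along the whole orbit, so the force is at most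
    [eta * (l * Num.sqrt l)] in each coordinate at all times. Over a time [T / l] the mean value
    theorem, used once for the momentum and once more for the position, gives deviations
    [T * eta * Num.sqrt l] and [T ^+ 2 * eta / Num.sqrt l]. *)
Lemma flow_nearly_straight (T e : R) : 0 < T -> 0 < e ->
  exists2 l0, 0 < l0 & forall l rho t, l0 <= l -> hamiltonian V rho = l ^+ 2 ->
    `|t| <= T / l ->
    enorm ((phi t rho).1 - (rho.1 + t *: rho.2)) <= e / Num.sqrt l /\
    enorm ((phi t rho).2 - rho.2) <= e * Num.sqrt l.
Proof.
(* [T] and [T ^+ 2] come from the momentum and the position estimate, [d] from passing from
   coordinates to the norm; the 1 keeps the denominator positive for every [d]. *)
move=> T0 e0; pose eta := e / (d%:R * (T + T ^+ 2) + 1).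
have D0 : 0 < d%:R * (T + T ^+ 2) + 1.
  by rewrite ltr_wpDl// mulr_ge0// addr_ge0 ?sqr_ge0// ltW.
have eta0 : 0 < eta by rewrite divr_gt0.
have etaE : d%:R * (T + T ^+ 2) * eta <= e.
  rewrite /eta mulrCA ger_pMr// ler_pdivrMr// mul1r; lra.
clearbody eta.
have [l0 l00 gradP] := small_gradient VC1 V_ge0 gradV eta0.
exists l0 => // l rho t l0l Hl tT.
have lp : 0 < l by exact: lt_le_trans l0l.
have sl : 0 < Num.sqrt l by rewrite sqrtr_gt0.
have slE : Num.sqrt l ^+ 2 = l by rewrite sqr_sqrtr// ltW.
have Vs s : V (phi s rho).1 <= l ^+ 2.
  rewrite -Hl -(energy_conservation rho s) /hamiltonian lerDl.
  by rewrite mulr_ge0// ?invr_ge0// sqr_ge0.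
have dxi s i : `|s| <= T / l ->
    `|(phi s rho).2 ord0 i - rho.2 ord0 i| <= T * eta * Num.sqrt l.
  move=> sT.
  have [u us e1] := @mean_value R (fun s => (phi s rho).2 ord0 i)
    (fun s => - partial V i (phi s rho).1) s (fun u _ => is_derive_momentum rho u i).
  rewrite flow0 in e1; rewrite e1 normrM normrN.
  apply: le_trans (ler_pM _ _ (gradP l _ i l0l (Vs u)) sT) _ => //.
  have -> : eta * (l * Num.sqrt l) * (T / l) = T * eta * Num.sqrt l.
    by field; rewrite gt_eqF.
  by [].
have dx i : `|(phi t rho).1 ord0 i - (rho.1 ord0 i + t * rho.2 ord0 i)| <=
    T ^+ 2 * eta / Num.sqrt l.
  (* Subtracting the straight motion leaves a function whose derivative is the change of momentum
     bounded above. *)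
  have [|u us] := @mean_value R
    (fun s => (phi s rho).1 ord0 i - s * rho.2 ord0 i)
    (fun s => (phi s rho).2 ord0 i - rho.2 ord0 i) t.
    move=> u _.
    have dB := is_deriveB (is_derive_position rho u i)
      (is_deriveZ (rho.2 ord0 i) (is_derive_id u (1 : R))).
    rewrite (_ : (fun s => _) =
      (fun s => (phi s rho).1 ord0 i) - rho.2 ord0 i \*: id); last first.
      by apply/funext => s; rewrite /GRing.scale/= [s * _]mulrC.
    by apply: is_derive_eq dB _; rewrite /GRing.scale/= mulr1.
  rewrite flow0 mul0r subr0 => e1.
  have -> : (phi t rho).1 ord0 i - (rho.1 ord0 i + t * rho.2 ord0 i) =
    (phi t rho).1 ord0 i - t * rho.2 ord0 i - rho.1 ord0 i by ring.
  rewrite e1 normrM.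
  apply: le_trans (ler_pM _ _ (dxi u i (le_trans us tT)) tT) _ => //.
  have -> : T * eta * Num.sqrt l * (T / l) = T ^+ 2 * eta / Num.sqrt l.
    by rewrite -[in T / l]slE; field; rewrite gt_eqF.
  by [].
split.
- apply: le_trans (enorm_le_cst (e := T ^+ 2 * eta / Num.sqrt l) _) _.
    by move=> i; rewrite !mxE.
  have -> : d%:R * (T ^+ 2 * eta / Num.sqrt l) = d%:R * T ^+ 2 * eta / Num.sqrt l by ring.
  rewrite ler_pM2r ?invr_gt0//; apply: le_trans etaE.
  by rewrite ler_pM2r// ler_wpM2l// lerDr ltW.
- apply: le_trans (enorm_le_cst (e := T * eta * Num.sqrt l) _) _.
    by move=> i; rewrite !mxE; exact: dxi.
  have -> : d%:R * (T * eta * Num.sqrt l) = d%:R * T * eta * Num.sqrt l by ring.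
  rewrite ler_pM2r//; apply: le_trans etaE.
  by rewrite ler_pM2r// ler_wpM2l// lerDl sqr_ge0.
Qed.

End hamiltonian_flow.

(** * Control along orbits, along lines and at infinity *)

Section limf_einf_gt0.
Context {R : realType}.

Lemma limf_einf_gt0 (T : choiceType) (X : filteredType T) (f : X -> \bar R)
    (F : set_system X) :
  (0 < limf_einf f F)%E <->
  exists c : R, 0 < c /\ exists2 A, F A & forall x, A x -> (c%:E <= f x)%E.
Proof.
rewrite limf_einfE; split=> [/ereal_sup_gt[_ [A FA <-]] infA|[c [c0 [A FA Ac]]]].
  have [c c0 cA] : exists2 c : R, 0 < c & (c%:E <= ereal_inf (f @` A))%E.
    (* The infimum may be [+oo], for instance on an empty set; any positive constant then serves. *)
    move: infA; case: (ereal_inf _) => [c|_|//]; last by exists 1; rewrite ?leey.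
    by rewrite lte_fin => c0; exists c.
  exists c; split=> //; exists A => // x Ax; apply: le_trans cA _.
  by apply: ereal_inf_lbound; exists x.
apply: (@lt_le_trans _ _ c%:E); first by rewrite lte_fin.
apply: (@le_trans _ _ (ereal_inf (f @` A))); last by apply: ereal_sup_ubound; exists A.
by apply: le_ereal_inf_tmp => _ [x Ax <-]; exact: Ac.
Qed.

End limf_einf_gt0.

(** * The implications between the three control conditions *)

Section control.
Context {R : realType} {d : nat} (V : 'rV[R]_d -> R)
  (phi : R -> 'rV[R]_d * 'rV[R]_d -> 'rV[R]_d * 'rV[R]_d)
  (K : R -> 'rV[R]_d -> R).
Implicit Types (x : 'rV[R]_d) (rho : 'rV[R]_d * 'rV[R]_d).

(* [K r] stands for [b * kappa_r], of which only the hypotheses on [K] below are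
   used; the next three properties are then the dynamical, the geometric and the
   turning point condition. *)
Definition orbit_control := exists T r c l0 : R, [/\ 0 < T, 0 < r, 0 < c &
  forall l rho, l0 < l -> hamiltonian V rho = l ^+ 2 ->
    c <= time_average (fun t => K (r / Num.sqrt l) (phi t rho).1) (T / l)].

Definition line_control := exists T c : R, [/\ 0 < T, 0 < c &
  forall x nu, enorm nu = 1 -> forall r : R, 0 < r ->
    c <= time_average (fun t => K r (x + t *: nu)) T].

Definition far_control := exists r c r0 : R, [/\ 0 < r, 0 < c &
  forall x, r0 < enorm x -> c <= K (r / (V x `^ (1 / 4))) x].

Hypothesis d_gt0 : (0 < d)%N.
Hypothesis VC1 : C1 V.
Hypothesis cV : continuous V.
Hypothesis V_ge0 : forall x, 0 <= V x.
Hypothesis V_infty : V x @[x --> at_infty] --> +oo.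
Hypothesis gradV :
  (fun x => enorm (gradient V x)) =o_at_infty (fun x => V x `^ (3 / 4)).
Hypothesis phiV : is_hamiltonian_flow V phi.
Hypothesis K_ge0 : forall r x, 0 < r -> 0 <= K r x.
Hypothesis le_K : forall r s x y, 0 < r -> enorm (x - y) + r <= s ->
  K r x <= (s / r) ^+ d * K s y.
Hypothesis sum_K_le : forall (I : finType) (x : I -> 'rV[R]_d) y r s, 0 < r -> 0 < s ->
  (forall i, eball (x i) r `<=` eball y s) ->
  (forall i j, i != j -> eball (x i) r `&` eball (x j) r = set0) ->
  \sum_i K r (x i) <= (s / r) ^+ d * K s y.
Hypothesis bounded_measurable_K : forall r (g : R -> 'rV[R]_d), 0 < r -> continuous g ->
  bounded_measurable (fun t => K r (g t)).

(** Doubling the radius absorbs a displacement of up to [r]. This is how averages along an orbit are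
    compared with averages at a nearby point or along a nearby line. *)
Let le_K2 r x y : 0 < r -> enorm (x - y) <= r -> K r x <= 2 ^+ d * K (2 * r) y.
Proof.
move=> r0 xy; have := @le_K r (2 * r) x y r0.
rewrite mulfK ?gt_eqF//; apply.
by rewrite mulr_natl mulr2n lerD2r.
Qed.

Let continuous_line x v : continuous (fun t : R => x + t *: v).
Proof.
move=> t; apply: cvgD; first exact: cvg_cst.
exact: scalel_continuous.
Qed.

Let quarter_le (v s : R) : 0 <= v -> 0 <= s -> v <= s ^+ 4 -> v `^ (1 / 4) <= s.
Proof.
move=> v0 s0 vs; have -> : s = (s ^+ 4) `^ (1 / 4).
  by rewrite -powR_mulrn// -powRrM (_ : 4%:R * (1 / 4) = 1 :> R) ?powRr1//; field.
by apply: ge0_ler_powR; rewrite ?nnegrE// ?exprn_ge0.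
Qed.

Let quarter_ge (v s : R) : 0 <= s -> s ^+ 4 <= v -> s <= v `^ (1 / 4).
Proof.
move=> s0 sv; have {1}-> : s = (s ^+ 4) `^ (1 / 4).
  by rewrite -powR_mulrn// -powRrM (_ : 4%:R * (1 / 4) = 1 :> R) ?powRr1//; field.
by apply: ge0_ler_powR; rewrite ?nnegrE// ?exprn_ge0// (le_trans _ sv)// exprn_ge0.
Qed.

(** The orbit from [(x, 0)] has energy [V x], so [l] is the square root of [V x] and [Num.sqrt l] is
    its fourth root. The straight reference motion is the constant [x], hence the orbit stays within
    [r / Num.sqrt l] of [x], and [le_K2] moves its average to [x] at twice the radius. *)
Lemma orbit_far_control : orbit_control -> far_control.
Proof.
move=> [T [r [c [l0 [T0 r0 c0 lP]]]]].
have [l1 l10 flowP] := flow_nearly_straight VC1 V_ge0 phiV gradV T0 r0.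
pose L := `|l0| + l1 + 1.
have L0 : 0 < L by rewrite /L ltr_wpDl// addr_ge0// ltW.
have /near_at_infty[r1 r1P] : \forall x \near at_infty, L ^+ 2 < V x.
  by move/cvgryPgt : V_infty; exact.
exists (2 * r), (c / 2 ^+ d), r1.
split; [exact: mulr_gt0|by rewrite divr_gt0// exprn_gt0|].
move=> x /r1P LV.
pose l := Num.sqrt (V x); have lE : l ^+ 2 = V x by rewrite sqr_sqrtr.
have Ll : L < l by rewrite -(@ltr_pXn2r _ 2)// ?nnegrE ?sqrtr_ge0 ?ltW// lE.
have lp : 0 < l by exact: lt_trans Ll.
have sp : 0 < Num.sqrt l by rewrite sqrtr_gt0.
have -> : V x `^ (1 / 4) = Num.sqrt l.
  have sE : Num.sqrt l ^+ 4 = V x by rewrite (exprM _ 2 2) sqr_sqrtr ?lE// ltW.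
  by apply/eqP; rewrite eq_le quarter_le ?quarter_ge ?sE ?sqrtr_ge0.
have l0l : l0 < l.
  by have := ler_norm l0; rewrite /L in Ll; lra.
have l1l : l1 <= l by have := normr_ge0 l0; rewrite /L in Ll; lra.
have Hx : hamiltonian V (x, 0) = l ^+ 2.
  by rewrite /hamiltonian/= enorm0 expr0n mulr0 addr0 lE.
have rs0 : 0 < r / Num.sqrt l by rewrite divr_gt0.
have Tl : 0 < T / l by rewrite divr_gt0.
have rs2 : 0 < 2 * r / Num.sqrt l by rewrite divr_gt0// mulr_gt0.
have K0 : 0 <= 2 ^+ d * K (2 * (r / Num.sqrt l)) x.
  by rewrite mulr_ge0 ?exprn_ge0// K_ge0// mulrA.
have cK : c <= 2 ^+ d * K (2 * (r / Num.sqrt l)) x.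
  apply: le_trans (lP l (x, 0) l0l Hx) _.
  rewrite -[leRHS](time_average_cst _ Tl); apply: le_time_average => //.
  - by apply: bounded_measurable_K => //; exact: continuous_position phiV _.
  - exact: bounded_measurable_cst.
  move=> t tT; apply: le_K2 => //.
  by have [] := flowP l (x, 0) t l1l Hx tT; rewrite /= scaler0 addr0.
by rewrite ler_pdivrMr ?exprn_gt0// mulrC -mulrA.
Qed.

Lemma line_far_orbit_control : line_control -> far_control -> orbit_control.
Proof.
move=> [T [c [T0 c0 Tc]]] [r [c1 [r1 [r0 c10 r1P]]]].
have [l1 l10 flowP] := flow_nearly_straight VC1 V_ge0 phiV gradV T0 r0.
have [C CP] := continuous_bounded_on_ball r1 cV.
pose L := l1 + 16 * r ^+ 2 + 16 * (`|C| + 1).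
have e20 : 0 < 2 ^+ d :> R by rewrite exprn_gt0.
pose c' := Num.min (c1 / 2 ^+ d) (c / 2 / 2 ^+ d).
exists T, (2 * r), c', L; split=> //.
- exact: mulr_gt0.
- by rewrite lt_min !divr_gt0.
move=> l [x xi] Ll Hl.
have C0 := normr_ge0 C; have r20 := sqr_ge0 r.
have l1l : l1 <= l by move: Ll; rewrite /L; lra.
have lp : 0 < l by exact: lt_le_trans l1l.
have rl : 16 * r ^+ 2 <= l by move: Ll; rewrite /L; lra.
have Cl : 16 * (`|C| + 1) <= l by move: Ll; rewrite /L; lra.
pose s := Num.sqrt l; have s0 : 0 < s by rewrite sqrtr_gt0.
have sE : s ^+ 2 = l by rewrite sqr_sqrtr// ltW.
have s4 : s ^+ 4 = l ^+ 2 by rewrite -sE -exprM.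
have rs0 : 0 < r / s by rewrite divr_gt0.
have Tl : 0 < T / l by rewrite divr_gt0.
have bK : bounded_measurable (fun t => K (2 * (r / s)) (phi t (x, xi)).1).
  by apply: bounded_measurable_K; [exact: mulr_gt0|exact: continuous_position phiV _].
rewrite -/s -mulrA.
have [xil|lxi] := leP (enorm xi) l.
  apply: le_trans (_ : c1 / 2 ^+ d <= _); first by rewrite ge_min lexx.
  rewrite -[leLHS](time_average_cst _ Tl); apply: le_time_average => //.
    by apply: bounded_measurable_cst; rewrite divr_ge0// ltW.
  move=> t tT; rewrite ler_pdivrMr//.
  have [_ xit] := flowP l (x, xi) t l1l Hl tT.
  set y := (phi t (x, xi)).1; set eta := (phi t (x, xi)).2 in xit.
  have Vy : V y + 2^-1 * enorm eta ^+ 2 = l ^+ 2.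
    by rewrite -Hl -(energy_conservation VC1 phiV (x, xi) t).
  (* The kinetic energy is then at most [25 / 32 * l ^+ 2], which leaves [7 / 32 * l ^+ 2] for
     [V y], more than the [l ^+ 2 / 16] required next. *)
  have etal : enorm eta <= 5 / 4 * l.
    have rs : r * s <= l / 4.
      rewrite -sE; have : 4 * r <= s.
        have : (4 * r) ^+ 2 <= s ^+ 2 by rewrite sE exprMn; lra.
        by rewrite ler_pXn2r// ?nnegrE ?ltW ?mulr_gt0.
      move=> rs; rewrite expr2; nra.
    have : enorm eta <= enorm (eta - xi) + enorm xi.
      by have := enormD (eta - xi) xi; rewrite subrK.
    move: xit; rewrite -/s /=; lra.
  have Vl : (s / 2) ^+ 4 <= V y.
    rewrite expr_div_n s4; have := enorm_ge0 eta => eta0; nra.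
  have Vl' : V y <= s ^+ 4.
    by rewrite s4 -Vy lerDl mulr_ge0 ?invr_ge0 ?sqr_ge0.
  have yr1 : r1 < enorm y.
    rewrite ltNge; apply/negP => /CP; rewrite ger0_norm// => VC.
    have := ler_norm C; move: Vl; rewrite expr_div_n s4; nra.
  have q1 : s / 2 <= V y `^ (1 / 4) by apply: quarter_ge => //; rewrite divr_ge0// ltW.
  have q2 : V y `^ (1 / 4) <= s by apply: quarter_le => //; rewrite ltW.
  have cy := r1P y yr1; set q := V y `^ (1 / 4) in q1 q2 cy.
  have q0 : 0 < q by apply: lt_le_trans q1; rewrite divr_gt0.
  have rq0 : 0 < r / q by rewrite divr_gt0.
  apply: le_trans cy _; rewrite [leRHS]mulrC.
  (* Since [s / 2 <= q <= s], the radius [r / q] lies between [r / s] and [2 * (r / s)]; enlarging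
     it to the latter costs at most [2 ^+ d]. *)
  apply: (@le_trans _ _ ((2 * (r / s) / (r / q)) ^+ d * K (2 * (r / s)) y)).
    apply: le_K => //; rewrite subrr enorm0 add0r.
    have -> : 2 * (r / s) = r / q * (2 * q / s) by field; rewrite !gt_eqF.
    by rewrite ler_peMr ?(ltW rq0)// ler_pdivlMr//; lra.
  rewrite ler_wpM2r//; first by apply: K_ge0; exact: mulr_gt0.
  have -> : 2 * (r / s) / (r / q) = 2 * q / s by field; rewrite !gt_eqF.
  rewrite ler_pXn2r// ?nnegrE//; last first.
    by rewrite divr_ge0 ?mulr_ge0// ltW.
  by rewrite ler_pdivrMr// ler_pM2l.
pose sg := enorm xi; have sg0 : 0 < sg by exact: lt_trans lxi.
pose nu := sg^-1 *: xi.
have nu1 : enorm nu = 1.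
  by rewrite /nu enormZ gtr0_norm ?invr_gt0// mulVf// gt_eqF.
apply: le_trans (_ : c / 2 / 2 ^+ d <= _); first by rewrite ge_min lexx orbT.
have bline : bounded_measurable (fun u => K (r / s) (x + u *: nu)).
  by apply: bounded_measurable_K => //; exact: continuous_line.
have bscale := bounded_measurable_scale sg bline.
suff : c / 2 <= time_average (fun t => 2 ^+ d * K (2 * (r / s)) (phi t (x, xi)).1) (T / l).
  rewrite time_averageZ//; move: (time_average _ _) => a ca.
  by rewrite ler_pdivrMr// [leRHS]mulrC.
(* Dilating time by the speed [sg] gives unit speed on the line. The window becomes [sg * (T / l)],
   between [T] and [2 * T], so the control over [T] loses at most a factor 2. *)
apply: (@le_trans _ _ (time_average (fun t => K (r / s) (x + (sg * t) *: nu)) (T / l))).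
  rewrite (time_average_scale _ sg0 bline).
  have sgl : sg <= 2 * l.
    have : sg ^+ 2 <= (2 * l) ^+ 2.
      have := V_ge0 x; have := sqr_ge0 l; move: Hl.
      by rewrite /hamiltonian/= -/sg exprMn => Hl l2 Vx; lra.
    by rewrite ler_pXn2r// ?nnegrE ?mulr_ge0 ?ltW.
  have TT : T <= sg * (T / l).
    by rewrite mulrA ler_pdivlMr// mulrC ler_pM2r// ltW.
  have := time_average_widen T0 TT bline.
  move/(le_trans (ler_wpM2l (ltW T0) (Tc x nu nu1 (r / s) rs0))) => H.
  have sgT : 0 < sg * (T / l) by rewrite mulr_gt0.
  rewrite -(ler_pM2l sgT); apply: le_trans H.
  have -> : sg * (T / l) * (c / 2) = T * (c * (sg / (2 * l))) by field; rewrite gt_eqF.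
  rewrite ler_pM2l// ger_pMr// ler_pdivrMr ?mulr_gt0// mul1r.
  exact: sgl.
apply: le_time_average => //; first by apply: bounded_measurableZ => //; rewrite ltW.
move=> t tT; apply: le_K2 => //.
have [+ _] := flowP l (x, xi) t l1l Hl tT.
by rewrite -enormN opprB /nu scalerA [sg * t]mulrC mulfK ?gt_eqF.
Qed.

(** Transfers the orbit bound to one line, at the radius tied to the energy. The condition
    [V y <= l ^+ 2 / 2] leaves enough kinetic energy at [y] for a speed of at least [l] in the
    direction [nu]. *)
Let line_average_ge (T r c l : R) (y nu : 'rV[R]_d) :
  0 < T -> 0 < r -> 0 < c -> 0 < l -> V y <= l ^+ 2 / 2 -> enorm nu = 1 ->
  (forall rho, hamiltonian V rho = l ^+ 2 ->
    c <= time_average (fun t => K (r / Num.sqrt l) (phi t rho).1) (T / l)) ->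
  (forall rho t, hamiltonian V rho = l ^+ 2 -> `|t| <= T / l ->
    enorm ((phi t rho).1 - (rho.1 + t *: rho.2)) <= r / Num.sqrt l) ->
  c / (2 * 2 ^+ d) <= time_average (fun u => K (2 * (r / Num.sqrt l)) (y + u *: nu)) (2 * T).
Proof.
move=> T0 r0 c0 l0 Vy nu1 lP flowP.
have s0 : 0 < Num.sqrt l by rewrite sqrtr_gt0.
have rs0 : 0 < r / Num.sqrt l by rewrite divr_gt0.
have rs2 : 0 < 2 * (r / Num.sqrt l) by rewrite mulr_gt0.
have Tl : 0 < T / l by rewrite divr_gt0.
have e20 : 0 < 2 ^+ d :> R by rewrite exprn_gt0.
(* The momentum [sg *: nu] puts [(y, sg *: nu)] on the energy level [l ^+ 2]; as
   [l <= sg <= 2 * l], its orbit covers between [T] and [2 * T] of the line. *)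
pose sg := Num.sqrt (2 * (l ^+ 2 - V y)).
have sgE : sg ^+ 2 = 2 * (l ^+ 2 - V y).
  by rewrite sqr_sqrtr// mulr_ge0//; have := sqr_ge0 l; lra.
have lsg : l <= sg.
  by rewrite -(@ler_pXn2r _ 2)// ?nnegrE ?sqrtr_ge0 ?(ltW l0)// sgE; lra.
have sg0 : 0 < sg by exact: lt_le_trans lsg.
have sgl : sg <= 2 * l.
  rewrite -(@ler_pXn2r _ 2)// ?nnegrE ?mulr_ge0 ?(ltW sg0) ?(ltW l0)// sgE exprMn.
  by have := V_ge0 y; have := sqr_ge0 l; lra.
have Hy : hamiltonian V (y, sg *: nu) = l ^+ 2.
  by rewrite /hamiltonian/= enormZ nu1 mulr1 gtr0_norm// sgE; field.
have bline : bounded_measurable (fun u => K (2 * (r / Num.sqrt l)) (y + u *: nu)).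
  by apply: bounded_measurable_K => //; exact: continuous_line.
have bscale := bounded_measurable_scale sg bline.
have cK : c <= 2 ^+ d * time_average
    (fun u => K (2 * (r / Num.sqrt l)) (y + u *: nu)) (sg * (T / l)).
  apply: le_trans (lP _ Hy) _.
  apply: (@le_trans _ _ (time_average (fun t =>
      2 ^+ d * K (2 * (r / Num.sqrt l)) (y + (sg * t) *: nu)) (T / l))); last first.
    by rewrite (time_averageZ _ _ bscale) (time_average_scale _ sg0 bline).
  apply: le_time_average => //.
  - by apply: bounded_measurable_K => //; exact: continuous_position phiV _.
  - by apply: bounded_measurableZ => //; rewrite ltW.
  move=> t tT; apply: le_K2 => //.
  have := flowP _ t Hy tT.
  by rewrite /= scalerA [sg * t]mulrC.
have sgT : 0 < sg * (T / l) by rewrite mulr_gt0.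
have sgT2 : sg * (T / l) <= 2 * T.
  by rewrite mulrA ler_pdivrMr// mulrAC ler_pM2r.
have := time_average_widen sgT sgT2 bline.
set a1 := time_average _ _ in cK *; set a2 := time_average _ _.
clearbody a1 a2 => a12.
have a1_ge : c / 2 ^+ d <= a1 by rewrite ler_pdivrMr// mulrC.
rewrite invfM mulrCA ler_pdivrMl//.
have TT : T <= sg * (T / l) by rewrite mulrA ler_pdivlMr// mulrC ler_pM2r.
have a10 : 0 <= a1 by apply: le_trans a1_ge; rewrite divr_ge0// ltW.
(* [T * a1 <= sg * (T / l) * a1 <= 2 * T * a2], hence the extra factor 2 in the constant. *)
apply: le_trans a1_ge _; rewrite -(ler_pM2l T0) mulrCA.
apply: le_trans (ler_wpM2r a10 TT) (le_trans a12 _).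
by rewrite mulrA.
Qed.

(** The energy to be used depends on [x0] and [q], but the constant must not. With [m ^ d] balls of
    radius [p], the comparison factor [(q / p) ^+ d] is [(2 * d * m) ^ d]; dividing by the number of
    balls removes [m] and leaves [(2 * d) ^ d]. *)
Lemma orbit_line_control : orbit_control -> line_control.
Proof.
move=> [T [r [c [l0 [T0 r0 c0 lP]]]]].
have [l1 l10 flowP] := flow_nearly_straight VC1 V_ge0 phiV gradV T0 r0.
have dR : 0 < d%:R :> R by rewrite ltr0n.
have e20 : 0 < 2 ^+ d :> R by rewrite exprn_gt0.
exists (2 * T), (c / (2 * 2 ^+ d) / (2 * d%:R) ^+ d); split.
- exact: mulr_gt0.
- by rewrite !divr_gt0// ?mulr_gt0// exprn_gt0// mulr_gt0.
move=> x0 nu nu1 q q0.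
have [C CP] := continuous_bounded_on_ball (enorm x0 + q) cV.
pose B := `|l0| + l1 + 2 * `|C| + 1.
(* A grid of [m ^ d] balls of radius [p = 2 * r / sqrt l = q / (2 * d * m)] fits
   into the ball of radius [q]. *)
pose m := (Num.truncn (B * q / (4 * r * d%:R))).+1.
have mB : B * q / (4 * r * d%:R) < m%:R by exact: truncnS_gt.
have m0 : 0 < m%:R :> R by rewrite ltr0n.
clearbody m.
pose s := 4 * r * d%:R * m%:R / q.
have Bs : B < s.
  rewrite /s ltr_pdivlMr// [ltRHS]mulrC -ltr_pdivrMr// mulr_gt0// mulr_gt0//.
have [[[l00 l1g] Cg] lB] := (normr_ge0 l0, l10, normr_ge0 C, Bs).
pose l := s ^+ 2.
have s1 : 1 <= s by move: lB; rewrite /B; lra.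
have s0 : 0 < s by lra.
have sl : s <= l by rewrite /l expr2 ler_peMr// ltW.
have sqrtl : Num.sqrt l = s by rewrite sqrtr_sqr gtr0_norm.
have Bl : B < l by exact: lt_le_trans sl.
have lp : 0 < l by exact: lt_le_trans sl.
have l0l : l0 < l by have := ler_norm l0; move: Bl; rewrite /B; lra.
have l1l : l1 <= l by move: Bl; rewrite /B; lra.
pose p := 2 * (r / s).
have pE : p = q / (2 * d%:R * m%:R) by rewrite /p /s; field; rewrite !gt_eqF.
have p0 : 0 < p by rewrite mulr_gt0// divr_gt0.
have p20 : 0 < 2 * p by exact: mulr_gt0.
pose y (k : {ffun 'I_d -> 'I_m}) := x0 + \row_i (2 * p * (k i)%:R).
(* Coordinates are at most [2 * p * (m - 1)], so the norm is at most [d] times this. Adding [p]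
   stays below [2 * d * m * p = q] because [1 <= d]. *)
have y_close k : enorm (y k - x0) + p <= q.
  have kP i : `|(y k - x0) ord0 i| <= 2 * p * (m%:R - 1).
    rewrite /y addrAC subrr add0r mxE ger0_norm; last by apply: mulr_ge0 => //; exact: ltW.
    by rewrite ler_pM2l// lerBrDr natr1 ler_nat.
  have := enorm_le_cst kP.
  have d1 : 1 <= d%:R :> R by rewrite ler1n.
  have -> : q = 2 * d%:R * m%:R * p by rewrite pE; field; rewrite !gt_eqF.
  have : p <= d%:R * p by rewrite ler_peMl// ltW.
  nra.
have y_avg k : c / (2 * 2 ^+ d) <= time_average (fun u => K p (y k + u *: nu)) (2 * T).
  have := @line_average_ge T r c l (y k) nu T0 r0 c0 lp.
  rewrite sqrtl; apply=> //.
  - have /CP : enorm (y k) <= enorm x0 + q.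
      have := enormD (y k - x0) x0; rewrite subrK; have := y_close k; lra.
    rewrite ger0_norm// => VC; have := ler_norm C; move: Bl sl s1; rewrite /B /l => Bl sl s1; nra.
  - by move=> rho; rewrite -sqrtl; exact: lP.
  - by move=> rho t Hr tT; rewrite -sqrtl; have [] := flowP l rho t l1l Hr tT.
have sumK u : \sum_k K p (y k + u *: nu) <= (q / p) ^+ d * K q (x0 + u *: nu).
  apply: sum_K_le => //.
    by move=> k; apply: eball_subset; rewrite opprD addrACA subrr addr0.
  (* Distinct centres differ by at least [2 * p] in some coordinate, and that coordinate alone
     separates the two open balls. *)
  have disjoint_lt (k k' : {ffun 'I_d -> 'I_m}) i z : (k i < k' i)%N ->
      eball (y k + u *: nu) p z -> eball (y k' + u *: nu) p z -> False.
    move=> kk' /(le_lt_trans (coord_le_enorm _ i)) z1.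
    move=> /(le_lt_trans (coord_le_enorm _ i)).
    have : 2 * p * ((k i)%:R + 1) <= 2 * p * (k' i)%:R.
      by rewrite ler_pM2l// natr1 ler_nat.
    by move: z1; rewrite !mxE !ltr_norml => /andP[? ?] ? /andP[? ?]; lra.
  move=> k k' kk'; rewrite -subset0 => z [z1 z2].
  have /existsP[i] : [exists i, k i != k' i].
    apply: contraNT kk'; rewrite negb_exists => /forallP kk'.
    by apply/eqP/ffunP => i; apply/eqP; rewrite -[_ == _]negbK.
  by rewrite neq_ltn => /orP[] kk'i;
    [exact: disjoint_lt kk'i z1 z2|exact: disjoint_lt kk'i z2 z1].
have bl r' z : 0 < r' -> bounded_measurable (fun u => K r' (z + u *: nu)).
  by move=> r'0; apply: bounded_measurable_K => //; exact: continuous_line.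
have T20 : 0 < 2 * T by exact: mulr_gt0.
have : \sum_(k : {ffun 'I_d -> 'I_m}) c / (2 * 2 ^+ d) <=
    (q / p) ^+ d * time_average (fun u => K q (x0 + u *: nu)) (2 * T).
  apply: (@le_trans _ _ (\sum_k time_average (fun u => K p (y k + u *: nu)) (2 * T))).
    by apply: ler_sum => k _; exact: y_avg.
  rewrite -time_average_sum//; last by move=> k; exact: bl.
  rewrite -time_averageZ; last exact: bl.
  apply: le_time_average => //.
  - by apply: bounded_measurable_sum => k; exact: bl.
  - apply: bounded_measurableZ; last exact: bl.
    by rewrite exprn_ge0// divr_ge0// ltW.
rewrite sumr_const card_ffun !card_ord -[leLHS]mulr_natl natrX.
have -> : q / p = 2 * d%:R * m%:R by rewrite pE; field; rewrite !gt_eqF.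
move: (time_average _ _) => a; rewrite exprMn -[leRHS]mulrA [leRHS]mulrCA ler_pM2l ?exprn_gt0//.
by move=> ca; rewrite ler_pdivrMr ?exprn_gt0 ?mulr_gt0// [leRHS]mulrC.
Qed.

End control.

(** * Translation of the three conditions and conclusion *)

Section stabilization.
Context {R : realType} {d : nat} (V b : 'rV[R]_d -> R)
  (phi : R -> 'rV[R]_d * 'rV[R]_d -> 'rV[R]_d * 'rV[R]_d).
Implicit Types (x : 'rV[R]_d) (rho : 'rV[R]_d * 'rV[R]_d).

Lemma dynamical_stabilizationP :
  dynamical_stabilization V phi b <-> orbit_control V phi (mollified b).
Proof.
split=> [[T [r [T0 r0 /limf_einf_gt0[c [c0 [A [l0 [_ l0A]] Ac]]]]]]|].
  exists T, r, c, l0; split=> // l rho l0l Hl.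
  rewrite -lee_fin; apply: le_trans (Ac l (l0A l l0l)) _.
  by apply: ereal_inf_lbound; exists rho.
move=> [T [r [c [l0 [T0 r0 c0 lP]]]]]; exists T, r; split=> //.
apply/limf_einf_gt0; exists c; split=> //; exists [set l | l0 < l].
  by exists l0; split=> //; exact: num_real.
move=> l l0l; apply: le_ereal_inf_tmp => _ [rho Hl <-].
by rewrite lee_fin; exact: lP.
Qed.

Lemma turning_point_conditionP : (0 < d)%N -> V x @[x --> at_infty] --> +oo ->
  measurable_fun [set: 'rV[R]_d] b -> {ae @lebesgue_rV R d, forall x, 0 <= b x} ->
  forall M, {ae @lebesgue_rV R d, forall x, b x <= M} ->
  turning_point_condition V b <-> far_control V (mollified b).
Proof.
move=> d0 Voo mb b0 M bM.
have [[m1 m2] [/= m10 m20] mP] := ball_average_mollified d0 mb b0 bM.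
(* Where [V x = 0] the quotient [r / V x ^ (1 / 4)] takes the default value 0; far out [V] is
   positive and the radius is a genuine one. *)
have /near_at_infty[r1 r1P] : \forall x \near at_infty, 0 < V x.
  by move/cvgryPgt : Voo; exact.
split=> [[r rp /limf_einf_gt0[c [c0 [A /near_at_infty[r0 r0A] Ac]]]]|].
  exists r, (c / m2), (Num.max r0 r1); split=> // [|x]; first exact: divr_gt0.
  rewrite gt_max => /andP[/r0A/Ac + /r1P Vx]; rewrite lee_fin => cx.
  have rV : 0 < r / V x `^ (1 / 4) by rewrite divr_gt0// powR_gt0.
  by rewrite ler_pdivrMr// mulrC; have /andP[_] := mP x _ rV; exact: le_trans.
move=> [r [c [r0 [rp c0 rP]]]]; exists r => //.
apply/limf_einf_gt0; exists (m1 * c); split; first exact: mulr_gt0.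
exists [set x | Num.max r0 r1 < enorm x].
  exists (Num.max r0 r1); split; first exact: num_real.
  by move=> r' r01 x; exact: lt_trans.
move=> x /=; rewrite gt_max lee_fin => /andP[r0x /r1P Vx].
have rV : 0 < r / V x `^ (1 / 4) by rewrite divr_gt0// powR_gt0.
have /andP[+ _] := mP x _ rV; apply: le_trans; rewrite ler_pM2l//.
exact: rP.
Qed.

Lemma uniform_geometric_controlP :
  uniform_geometric_control b <-> line_control (mollified b).
Proof. by []. Qed.

End stabilization.

Lemma Lfun_oo_ae_bounded {R : realType} {d : nat} (b : 'rV[R]_d -> R) :
  b \in Lfun (@lebesgue_rV R d) +oo%E ->
  exists M, {ae @lebesgue_rV R d, forall x, b x <= M}.
Proof.
move=> /andP[_]; rewrite inE/= /finite_norm unlock.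
(* The norm of exponent [+oo] is defined by cases: an essential supremum when the whole space has
   positive measure, and otherwise every property holds almost everywhere. *)
case: ifPn => [mu0 /ess_supr_bounded[M bM]|].
  by exists M; apply: filterS bM => x; apply: le_trans; exact: ler_norm.
rewrite -leNgt => mu0 _; exists 0; exists setT; split => //.
by apply/eqP; rewrite eq_le mu0 measure_ge0.
Qed.

Theorem proposition1p10 (R : realType) (d : nat) (V b : 'rV[R]_d -> R)
    (phi : R -> 'rV[R]_d * 'rV[R]_d -> 'rV[R]_d * 'rV[R]_d) :
  (1 <= d)%N ->
  class_C 2 V ->
  (forall x, 0 <= V x) ->
  V x @[x --> at_infty] --> +oo ->
  (fun x => enorm (gradient V x)) =o_at_infty (fun x => V x `^ (3 / 4)) ->
  is_hamiltonian_flow V phi ->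
  b \in Lfun (@lebesgue_rV R d) +oo%E ->
  {ae @lebesgue_rV R d, forall x, 0 <= b x} ->
  dynamical_stabilization V phi b <->
  uniform_geometric_control b /\ turning_point_condition V b.
Proof.
move=> d_gt0 VC2 V_ge0 Voo gradV phiV bL b_ge0.
have cV : continuous V by have [] := VC2.
have VC1 := class_C2_C1 VC2.
have mb : measurable_fun [set: 'rV[R]_d] b := set_mem (sub_Lfun_mfun bL).
have [M b_leM] := Lfun_oo_ae_bounded bL.
pose K := mollified b.
have K_ge0 r x : 0 < r -> 0 <= K r x by exact: (mollified_ge0 d_gt0 mb b_ge0 b_leM).
have le_K r s x y : 0 < r -> enorm (x - y) + r <= s -> K r x <= (s / r) ^+ d * K s y.
  exact: (le_mollified d_gt0 mb b_ge0 b_leM).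
have sum_K_le := @sum_mollified_le R d b d_gt0 mb b_ge0 M b_leM.
have bmK r (g : R -> 'rV[R]_d) : 0 < r -> continuous g ->
    bounded_measurable (fun t => K r (g t)).
  move=> r0 cg; split; first exact: (measurable_mollified_curve mb b_ge0 b_leM).
  have [C KC] := mollified_bounded d_gt0 mb b_ge0 b_leM r0.
  by exists C => t; rewrite K_ge0//= KC.
have TPP := @turning_point_conditionP R d V b d_gt0 Voo mb b_ge0 M b_leM.
split=> [/dynamical_stabilizationP OC|[/uniform_geometric_controlP LC /TPP FC]].
  split; last exact/TPP/(orbit_far_control VC1 V_ge0 Voo gradV phiV K_ge0 le_K bmK).
  apply/uniform_geometric_controlP.
  exact: (orbit_line_control d_gt0 VC1 cV V_ge0 gradV phiV le_K sum_K_le bmK).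
apply/dynamical_stabilizationP.
by apply: (line_far_orbit_control d_gt0 VC1 cV V_ge0 gradV phiV K_ge0 le_K bmK).
Qed.
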